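(* Let $X\subset\mathbb{R}^2$ be a planar self-affine set whose tuple of linear parts is dominated, satisfying the strong separation condition but not the projective open set condition, such that $X_F$ is not a singleton. Then $\dim_A(X)\ge1$.
   Context: An affine iterated function system is a tuple $(\varphi_1,\dots,\varphi_N)$, $N\ge2$, with $\varphi_i(x)=A_ix+v_i$, $A_i\in GL_2(\mathbb{R})$, $\|A_i\|<1$; its self-affine set $X$ is the unique nonempty compact set with $X=\bigcup_i\varphi_i(X)$; properties of $\mathsf{A}=(A_1,\dots,A_N)$ are attributed to $X$. For $\mathtt{i}=i_1\cdots i_n$, $A_{\mathtt{i}}=A_{i_1}\cdots A_{i_n}$, $\varphi_{\mathtt{i}}=\varphi_{i_1}\circ\cdots\circ\varphi_{i_n}$; $\Sigma_*$ is the set of finite words. Dominated: $\exists C>0,0<\tau<1$ with $\alpha_2(A_{\mathtt{i}})\le C\tau^{|\mathtt{i}|}\alpha_1(A_{\mathtt{i}})$ for all $\mathtt{i}\in\Sigma_*$, $\alpha_1\ge\alpha_2$ singular values. Strong separation condition: $\varphi_i(X)\cap\varphi_j(X)=\emptyset$ for $i\ne j$. Furstenberg directions: $X_F=\{A\mathbb{R}^2: A$ rank-one matrix in the closure of $\{cA_{i_1}^{-1}\cdots A_{i_n}^{-1}: c\in\mathbb{R}, i_1\cdots i_n\in\Sigma_*\}\}$. $\operatorname{proj}_W$ is orthogonal projection onto the line $W$. Projective open set condition: there is $\eta>0$ such that for every $V\in X_F$ and $\mathtt{i}\ne\mathtt{j}\in\Sigma_*$ there is $x\in X$ with $|\operatorname{proj}_{V^\perp}(\varphi_{\mathtt{i}}(x))-\operatorname{proj}_{V^\perp}(\varphi_{\mathtt{j}}(x))|\ge\eta\operatorname{diam}(\operatorname{proj}_{V^\perp}(\varphi_{\mathtt{i}}(X)))$.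 Assouad dimension $\dim_A(Y)$: infimum of $s\ge0$ such that for some $C$, for all $x\in Y$, $0<r<R$, $Y\cap B(x,R)$ is covered by at most $C(R/r)^s$ balls of radius $r$ centred in $Y$. *)

(* Defs.v *)
From HB Require Import structures.
From mathcomp Require Import all_boot all_order all_algebra.
From mathcomp Require Import all_classical all_reals all_analysis.
Set Implicit Arguments. Unset Strict Implicit. Unset Printing Implicit Defensive.
Import Order.TTheory GRing.Theory Num.Theory.
Import numFieldNormedType.Exports.
Local Open Scope classical_set_scope.
Local Open Scope ring_scope.

Section Defs.
Variable R : realType.

Definition dot2 (x y : 'cV[R]_2) : R := \sum_(i < 2) x i 0 * y i 0.
Definition enorm (x : 'cV[R]_2) : R := Num.sqrt (dot2 x x).

(* singular values: alpha1 = max_{|x|=1} |Ax| (operator norm), alpha2 = min_{|x|=1} |Ax| *)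
Definition alpha1 (A : 'M[R]_2) : R := sup [set enorm (A *m x) | x in [set x | enorm x = 1]].
Definition alpha2 (A : 'M[R]_2) : R := inf [set enorm (A *m x) | x in [set x | enorm x = 1]].

Definition aff (N : nat) (A : 'I_N -> 'M[R]_2) (v : 'I_N -> 'cV[R]_2) (i : 'I_N)
  (x : 'cV[R]_2) : 'cV[R]_2 := A i *m x + v i.

Definition mat_word N (A : 'I_N -> 'M[R]_2) (w : seq 'I_N) : 'M[R]_2 :=
  foldr (fun i M => A i *m M) 1%:M w.
Definition invmat_word N (A : 'I_N -> 'M[R]_2) (w : seq 'I_N) : 'M[R]_2 :=
  foldr (fun i M => invmx (A i) *m M) 1%:M w.
Definition aff_word N A v (w : seq 'I_N) (x : 'cV[R]_2) : 'cV[R]_2 :=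
  foldr (fun i y => aff A v i y) x w.

Definition is_self_affine_set N A v (X : set 'cV[R]_2) : Prop :=
  compact X /\ X !=set0 /\ X = \bigcup_(i in [set: 'I_N]) (aff A v i @` X).

Definition dominated N (A : 'I_N -> 'M[R]_2) : Prop :=
  exists C tau : R, 0 < C /\ 0 < tau < 1 /\
    forall w : seq 'I_N,
      alpha2 (mat_word A w) <= C * tau ^+ size w * alpha1 (mat_word A w).

Definition strong_separation N A v (X : set 'cV[R]_2) : Prop :=
  forall i j : 'I_N, i != j -> (aff A v i @` X) `&` (aff A v j @` X) = set0.

Definition furstenberg N (A : 'I_N -> 'M[R]_2) : set (set 'cV[R]_2) :=
  [set V | exists B : 'M[R]_2,
      closure [set c *: invmat_word A w | c in [set: R] & w in [set: seq 'I_N]] B /\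
      \rank B = 1%N /\ V = [set B *m x | x in [set: 'cV[R]_2]]].

Definition orth (V : set 'cV[R]_2) : set 'cV[R]_2 :=
  [set y | forall z, V z -> dot2 y z = 0].
Definition proj (W : set 'cV[R]_2) (y : 'cV[R]_2) : 'cV[R]_2 :=
  xget 0 [set p | W p /\ forall z, W z -> dot2 (y - p) z = 0].

Definition diam (S : set 'cV[R]_2) : R := sup [set enorm (x - y) | x in S & y in S].

Definition projective_osc N A v (X : set 'cV[R]_2) : Prop :=
  exists eta : R, 0 < eta /\
    forall V, furstenberg A V ->
    forall w1 w2 : seq 'I_N, w1 != w2 ->
      exists2 x, X x &
        enorm (proj (orth V) (aff_word A v w1 x) - proj (orth V) (aff_word A v w2 x))
          >= eta * diam (proj (orth V) @` (aff_word A v w1 @` X)).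

Definition assouad_dim (Y : set 'cV[R]_2) : R :=
  inf [set s : R | 0 <= s /\ exists C : R, forall x, Y x -> forall r Rad : R, 0 < r < Rad ->
        exists cs : seq 'cV[R]_2, (forall c, c \in cs -> Y c) /\
          (size cs)%:R <= C * powR (Rad / r) s /\
          (Y `&` [set y | enorm (y - x) < Rad]) `<=`
            [set y | exists2 c, c \in cs & enorm (y - c) < r]].
End Defs.

(* Main.v *)
(** Write [wedge b z] for the determinant of [(b, z)] and [G_i] for the adjugate of [A_i] scaled to
    determinant of modulus one, so that [wedge b (A_w z)] is a positive multiple of
    [wedge (G_(rev w) b) z], and Furstenberg directions are the directions [b] of rank one limits
    [x |-> (a . x) b] of multiples of words in the [G_i] (the predicate [limit_dir]).

    Domination says that the norms of words in the [G_i] grow exponentially. If a vector orbit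
    stayed above a fixed fraction of its two endpoints for [n] steps, then the norm of the product
    would be linear in [n]; hence orbits are quasi-convex, and a vector that has been expanded in the
    past keeps being expanded at a rate comparable to the norm of the word. In particular every word
    expands all Furstenberg directions comparably to its norm, and a suitable word sends all of them
    close to any prescribed one.

    Failure of the projective open set condition provides words [w1], [w2] and a Furstenberg direction
    [b] for which [g x := wedge b (phi_w1 x - phi_w2 x)] is small relative to the size of
    [wedge b (phi_w1 x)]; moving [b] slightly within the Furstenberg directions, of which there are at
    least two, and using strong separation, [g] does not vanish identically on [X]. By induction on
    [M] this yields points [p_0, ..., p_M] of [X] and a Furstenberg direction [b] such that the
    increments [wedge b (p_(m+1) - p_m)] all lie in [(c rho, rho)], with [c] independent of [M]: map
    the previous points by [phi_w1 phi_w], where [w] codes a point at which [g] is almost maximal and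
    has the length for which the increments become comparable to [g], and add one image under
    [phi_w2 phi_w]. Finally some [A_w] nearly factors through [wedge b], so that its image of the
    [p_m] consists of [M + 1] points of [X] at mutual distance at least [r] in a ball of radius
    [O(M r)]. *)
Require Import Defs.
From HB Require Import structures.
From mathcomp Require Import all_boot all_order all_algebra.
From mathcomp Require Import all_classical all_reals all_analysis.
From mathcomp Require Import ring lra.
Set Implicit Arguments. Unset Strict Implicit. Unset Printing Implicit Defensive.
Import Order.TTheory GRing.Theory Num.Theory.
Import numFieldNormedType.Exports.
Local Open Scope classical_set_scope.
Local Open Scope ring_scope.

(** * Plane geometry *)

Section Plane.
Variable R : realType.
Implicit Types (x y z : 'cV[R]_2) (A B : 'M[R]_2).

Definition wedge x y : R := x 0 0 * y 1 0 - x 1 0 * y 0 0.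

Definition rot x : 'cV[R]_2 := \col_i (if i == 0 then - x 1 0 else x 0 0).

Lemma dot2E x y : dot2 x y = x 0 0 * y 0 0 + x 1 0 * y 1 0.
Proof.
rewrite /dot2 big_ord_recl big_ord1; congr (_ + x _ _ * y _ _); exact/val_inj.
Qed.

Lemma mulmx2E A x i : (A *m x) i 0 = A i 0 * x 0 0 + A i 1 * x 1 0.
Proof.
rewrite mxE big_ord_recl big_ord1; congr (_ + A _ _ * x _ _); exact/val_inj.
Qed.

Lemma det2E A : \det A = A 0 0 * A 1 1 - A 0 1 * A 1 0.
Proof.
rewrite (expand_det_row _ 0) big_ord_recl big_ord1 /cofactor !det_mx11 !mxE /=.
have -> : lift 0 0 = 1 :> 'I_2 by exact/val_inj.
have -> : lift 1 0 = 0 :> 'I_2 by exact/val_inj.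
by rewrite expr0 expr1; ring.
Qed.

Lemma cV2P x y : x 0 0 = y 0 0 -> x 1 0 = y 1 0 -> x = y.
Proof.
move=> e0 e1; apply/matrixP => i j; rewrite ord1.
by case: (unliftP 0 i) => [k ->|->] //; rewrite ord1 (_ : lift _ _ = 1) //; exact/val_inj.
Qed.

Lemma rot0E x : rot x 0 0 = - x 1 0. Proof. by rewrite mxE. Qed.
Lemma rot1E x : rot x 1 0 = x 0 0. Proof. by rewrite mxE. Qed.

Lemma enorm_ge0 x : 0 <= enorm x. Proof. exact: sqrtr_ge0. Qed.

Lemma dot2_ge0 x : 0 <= dot2 x x.
Proof. by rewrite dot2E; nra. Qed.

Lemma enorm_sqr x : enorm x ^+ 2 = x 0 0 ^+ 2 + x 1 0 ^+ 2.
Proof. by rewrite sqr_sqrtr ?dot2_ge0 // dot2E !expr2. Qed.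

Lemma dot2xx x : dot2 x x = enorm x ^+ 2.
Proof. by rewrite sqr_sqrtr ?dot2_ge0. Qed.

Lemma enorm0_eq0 x : enorm x = 0 -> x = 0.
Proof.
move=> h; have := enorm_sqr x; rewrite h expr0n /= => e.
apply: cV2P; rewrite mxE; apply/eqP; rewrite -sqrf_eq0; apply/eqP; nra.
Qed.

Lemma enorm0 : enorm (0 : 'cV[R]_2) = 0.
Proof. by rewrite /enorm dot2E !mxE !mulr0 addr0 sqrtr0. Qed.

Lemma enorm_gt0 x : (0 < enorm x) = (x != 0).
Proof.
rewrite lt_def enorm_ge0 andbT; apply/idP/idP; apply: contra => /eqP.
  by move->; rewrite enorm0.
by move/enorm0_eq0 ->.
Qed.

Lemma enormZ c x : enorm (c *: x) = `|c| * enorm x.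
Proof.
apply/eqP; rewrite -(@eqrXn2 _ 2) ?enorm_ge0 ?mulr_ge0 ?enorm_ge0 //.
by rewrite exprMn !enorm_sqr !mxE !exprMn real_normK ?num_real // mulrDr.
Qed.

Lemma enormN x : enorm (- x) = enorm x.
Proof. by rewrite -scaleN1r enormZ normrN1 mul1r. Qed.

Lemma enormB x y : enorm (x - y) = enorm (y - x).
Proof. by rewrite -enormN opprB. Qed.

Lemma lagrange2 x y : dot2 x y ^+ 2 + wedge x y ^+ 2 = (enorm x * enorm y) ^+ 2.
Proof. by rewrite exprMn !enorm_sqr dot2E /wedge; ring. Qed.

Lemma ler_dot2 x y : `|dot2 x y| <= enorm x * enorm y.
Proof.
rewrite -(@ler_pXn2r _ 2) ?nnegrE ?mulr_ge0 ?enorm_ge0 //.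
by rewrite -lagrange2 real_normK ?num_real // lerDl sqr_ge0.
Qed.

Lemma ler_wedge x y : `|wedge x y| <= enorm x * enorm y.
Proof.
rewrite -(@ler_pXn2r _ 2) ?nnegrE ?mulr_ge0 ?enorm_ge0 //.
by rewrite -lagrange2 real_normK ?num_real // lerDr sqr_ge0.
Qed.

Lemma ler_enormD x y : enorm (x + y) <= enorm x + enorm y.
Proof.
rewrite -(@ler_pXn2r _ 2) ?nnegrE ?addr_ge0 ?enorm_ge0 //.
have h := ler_dot2 x y; have h2 := ler_norm (dot2 x y).
have -> : enorm (x + y) ^+ 2 = enorm x ^+ 2 + enorm y ^+ 2 + 2 * dot2 x y.
  by rewrite !enorm_sqr dot2E !mxE; ring.
rewrite sqrrD; lra.
Qed.

Lemma ler_enormB x y : enorm (x - y) <= enorm x + enorm y.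
Proof. by rewrite -(enormN y) ler_enormD. Qed.

Lemma ler_enorm_sub x y : enorm x - enorm y <= enorm (x - y).
Proof. by have := ler_enormD (x - y) y; rewrite subrK; lra. Qed.

Lemma enorm_rot x : enorm (rot x) = enorm x.
Proof.
apply/eqP; rewrite -(@eqrXn2 _ 2) ?enorm_ge0 //.
by rewrite !enorm_sqr rot0E rot1E sqrrN addrC.
Qed.

Lemma wedge_rot x : wedge x (rot x) = enorm x ^+ 2.
Proof. by rewrite enorm_sqr /wedge rot0E rot1E; ring. Qed.

Lemma dot2_rot x : dot2 x (rot x) = 0.
Proof. by rewrite dot2E rot0E rot1E; ring. Qed.

Lemma dot2rotl x y : dot2 (rot x) y = wedge x y.
Proof. by rewrite dot2E rot0E rot1E /wedge; ring. Qed.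

Lemma wedgexx x : wedge x x = 0. Proof. by rewrite /wedge; ring. Qed.
Lemma wedgeC x y : wedge x y = - wedge y x. Proof. by rewrite /wedge; ring. Qed.
Lemma wedgeDl x y z : wedge (x + y) z = wedge x z + wedge y z.
Proof. by rewrite /wedge !mxE; ring. Qed.
Lemma wedgeDr x y z : wedge z (x + y) = wedge z x + wedge z y.
Proof. by rewrite /wedge !mxE; ring. Qed.
Lemma wedgeNl x z : wedge (- x) z = - wedge x z.
Proof. by rewrite /wedge !mxE; ring. Qed.
Lemma wedgeNr x z : wedge z (- x) = - wedge z x.
Proof. by rewrite /wedge !mxE; ring. Qed.
Lemma wedgeBl x y z : wedge (x - y) z = wedge x z - wedge y z.
Proof. by rewrite wedgeDl wedgeNl. Qed.
Lemma wedgeBr x y z : wedge z (x - y) = wedge z x - wedge z y.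
Proof. by rewrite wedgeDr wedgeNr. Qed.
Lemma wedgeZl c x z : wedge (c *: x) z = c * wedge x z.
Proof. by rewrite /wedge !mxE; ring. Qed.
Lemma wedgeZr c x z : wedge z (c *: x) = c * wedge z x.
Proof. by rewrite /wedge !mxE; ring. Qed.

Lemma wedge_mulmx A x y : wedge (A *m x) (A *m y) = \det A * wedge x y.
Proof. by rewrite /wedge !mulmx2E det2E; ring. Qed.

Lemma wedge_cramer x y z : wedge x y *: z = wedge z y *: x + wedge x z *: y.
Proof. by apply: cV2P; rewrite !mxE /wedge; ring. Qed.

Lemma wedge_indep x y z : wedge x y != 0 -> wedge x z = 0 -> wedge y z = 0 -> z = 0.
Proof.
move=> h e1 e2; apply: (scalerI h).
by rewrite wedge_cramer e1 wedgeC e2 oppr0 !scale0r addr0 scaler0.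
Qed.

(** Testing against [rot y] suffices, since [wedge y (rot y)] is the squared norm. This duality is
    how norms of products of the [A i] are estimated. *)
Lemma enorm_le_wedge y m : 0 <= m -> (forall x, `|wedge x y| <= m * enorm x) -> enorm y <= m.
Proof.
move=> m0 h; have [->|y0] := eqVneq y 0; first by rewrite enorm0.
have := h (rot y); rewrite wedgeC normrN wedge_rot enorm_rot ger0_norm ?sqr_ge0 //.
by rewrite expr2 ler_pM2r // enorm_gt0.
Qed.

(** Orthogonal decomposition along [y] and [rot y], multiplied by the squared norm so that nothing
    is divided by it. *)
Lemma rot_decomp x y : enorm y ^+ 2 *: x = dot2 x y *: y + wedge y x *: rot y.
Proof.
by apply: cV2P; rewrite !mxE /= enorm_sqr dot2E /wedge; ring.
Qed.

Lemma mulmx_entry_bound A e x : (forall i j, `|A i j| <= e) -> enorm (A *m x) <= 2 * e * enorm x.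
Proof.
move=> h; have e0 : 0 <= e by apply: le_trans (h 0 0).
rewrite -(@ler_pXn2r _ 2) ?nnegrE ?mulr_ge0 ?enorm_ge0 //.
rewrite !exprMn !enorm_sqr !mulmx2E.
have sq i : (A i 0 * x 0 0 + A i 1 * x 1 0) ^+ 2 <= 2 * e ^+ 2 * (x 0 0 ^+ 2 + x 1 0 ^+ 2).
  have b j : A i j ^+ 2 <= e ^+ 2 by rewrite -(real_normK (num_real (A i j))) ler_pXn2r ?nnegrE.
  have b0 := ler_wpM2r (sqr_ge0 (x 0 0)) (b 0).
  have b1 := ler_wpM2r (sqr_ge0 (x 1 0)) (b 1).
  have := sqr_ge0 (A i 0 * x 0 0 - A i 1 * x 1 0); rewrite sqrrB sqrrD !exprMn; lra.
have := lerD (sq 0) (sq 1); lra.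
Qed.

Lemma mulmx_bounded A : exists2 L, 0 < L & forall x, enorm (A *m x) <= L * enorm x.
Proof.
pose e := \sum_i \sum_j `|A i j|.
have e0 : 0 <= e by apply: sumr_ge0 => i _; apply: sumr_ge0.
exists (2 * e + 1) => [|x]; first lra.
apply: le_trans (mulmx_entry_bound (e := e) _ _) _.
  move=> i j; rewrite /e (bigD1 i) //= (bigD1 j) //= -addrA lerDl addr_ge0 //.
    by apply: sumr_ge0.
  by apply: sumr_ge0 => k _; apply: sumr_ge0.
by rewrite ler_wpM2r ?enorm_ge0 // lerDl.
Qed.

End Plane.

(** * Cocycles with exponential growth *)

Section ExpLinear.
Variable R : realType.

Lemma bernoulli (d : R) n : 0 <= d -> 1 + n%:R * d <= (1 + d) ^+ n.
Proof.
move=> d0; elim: n => [|n IH]; first by rewrite mul0r addr0 expr0.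
have n0 : 0 <= n%:R :> R by [].
rewrite exprS -natr1; nra.
Qed.

(** Write [tau ^+ n] as [u ^+ 4]. By Bernoulli, [u] times the linear term stays below a constant
    [K], which uses up two factors [u]; the two that remain beat [C * K ^+ 2] for large [n]. *)
Lemma geometric_vs_square (C tau a b : R) : 0 < C -> 0 < tau < 1 -> 0 < a -> 0 < b ->
  exists n0, forall n, (n0 <= n)%N -> C * tau ^+ n * (a + n%:R * b) ^+ 2 < 1.
Proof.
move=> C0 /andP[t0 t1] a0 b0.
pose s := Num.sqrt (Num.sqrt tau).
have s0 : 0 < s by rewrite !sqrtr_gt0.
have s4 : s ^+ 4 = tau.
  by rewrite (exprM s 2 2) sqr_sqrtr ?sqrtr_ge0 // sqr_sqrtr // ltW.
have s1 : s < 1 by rewrite -(@ltr_pXn2r _ 4) ?nnegrE ?ler01 ?(ltW s0) // s4 expr1n.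
pose d := s^-1 - 1.
have d0 : 0 < d by rewrite subr_gt0 invf_gt1.
have sd : s * (1 + d) = 1 by rewrite /d addrC subrK divff ?gt_eqF.
pose K := a + b / d.
have K0 : 0 < K by rewrite addr_gt0 // divr_gt0.
have bd : b / d * d = b by rewrite divfK ?gt_eqF.
pose n0 := Num.bound (C * K ^+ 2 / d).
exists n0 => n n0n.
have n_ge0 : 0 <= n%:R :> R by [].
have hn : C * K ^+ 2 < n%:R * d.
  rewrite -ltr_pdivrMr //; apply: lt_le_trans (_ : n0%:R <= _); last by rewrite ler_nat.
  by apply: archi_boundP; rewrite ltW // divr_gt0 // mulr_gt0 // exprn_gt0.
have u1 : s ^+ n * (1 + n%:R * d) <= 1.
  rewrite [leRHS](_ : 1 = s ^+ n * (1 + d) ^+ n); last by rewrite -exprMn sd expr1n.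
  by rewrite ler_pM2l ?exprn_gt0 // bernoulli // ltW.
set u := s ^+ n in u1.
have u0 : 0 < u by rewrite exprn_gt0.
have lin : a + n%:R * b <= K * (1 + n%:R * d).
  have bd0 : 0 < b / d by rewrite divr_gt0.
  have e : K * (1 + n%:R * d) = a + n%:R * b + (a * (n%:R * d) + b / d).
    by rewrite /K -{2}bd; ring.
  by rewrite e lerDl addr_ge0 ?(ltW bd0) // !mulr_ge0 // ltW.
set q := 1 + n%:R * d in u1 lin.
have q0 : 0 < q by rewrite /q; nra.
have tn : tau ^+ n = u ^+ 4 by rewrite -s4 -!exprM mulnC.
have l2 : u * (a + n%:R * b) <= K.
  apply: le_trans (_ : u * (K * q) <= _); first by rewrite ler_pM2l.
  by rewrite mulrCA ler_piMr // ltW.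
have l3 : C * K ^+ 2 * u < 1.
  apply: lt_le_trans (_ : q * u <= _); last by rewrite mulrC.
  by rewrite ltr_pM2r // /q; lra.
have u1' : u <= 1 by rewrite /u exprn_ile1 ?ltW.
have l4 : 0 <= u * (a + n%:R * b) by rewrite mulr_ge0 ?ltW //; nra.
have -> : C * tau ^+ n * (a + n%:R * b) ^+ 2 = C * u ^+ 2 * (u * (a + n%:R * b)) ^+ 2.
  by rewrite tn; ring.
apply: le_lt_trans (_ : _ <= C * u ^+ 2 * K ^+ 2) _.
  rewrite ler_pM2l ?mulr_gt0 ?exprn_gt0 // ler_pXn2r ?nnegrE //; exact: ltW.
have : C * K ^+ 2 * u * u <= C * K ^+ 2 * u * 1.
  by rewrite ler_wpM2l // !mulr_ge0 ?sqr_ge0 // ltW.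
by rewrite mulr1 expr2; lra.
Qed.

End ExpLinear.

(** * Products along words and their rank one limits *)

Section Words.
Variables (R : realType) (N : nat) (G : 'I_N -> 'M[R]_2).
Implicit Types (x : 'cV[R]_2) (w : seq 'I_N).

Lemma mat_word_cat u w : mat_word G (u ++ w) = mat_word G u *m mat_word G w.
Proof. by elim: u => [|i u IH] /=; rewrite ?mul1mx // IH mulmxA. Qed.

Lemma act_nil x : mat_word G [::] *m x = x.
Proof. exact: mul1mx. Qed.

Lemma act_cons i w x : mat_word G (i :: w) *m x = G i *m (mat_word G w *m x).
Proof. by rewrite /= -mulmxA. Qed.

Lemma act_cat u w x :
  mat_word G (u ++ w) *m x = mat_word G u *m (mat_word G w *m x).
Proof. by rewrite mat_word_cat mulmxA. Qed.

Lemma act_rcons w i x : mat_word G (rcons w i) *m x = mat_word G w *m (G i *m x).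
Proof. by rewrite -cats1 act_cat /= mulmx1. Qed.

End Words.

Definition limit_dir (R : realType) N (G : 'I_N -> 'M[R]_2) (b : 'cV[R]_2) :=
  b != 0 /\ exists2 a : 'cV[R]_2, a != 0 & forall e, 0 < e -> exists (c : R) w,
    forall x, enorm (c *: (mat_word G w *m x) - dot2 a x *: b) <= e * enorm x.

Section Cocycle.
Variables (R : realType) (N : nat) (G : 'I_N -> 'M[R]_2) (L C tau : R).
Implicit Types (x y z : 'cV[R]_2) (w : seq 'I_N).
Hypothesis L1 : 1 < L.
Hypothesis Gdet : forall i, `|\det (G i)| = 1.
Hypothesis GL : forall i x, enorm (G i *m x) <= L * enorm x.
Hypothesis GV : forall i x, enorm x <= L * enorm (G i *m x).
Hypothesis C0 : 0 < C.
Hypothesis tau01 : 0 < tau < 1.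
(* Exponential growth of the operator norms: the form in which domination is used. *)
Hypothesis growth : forall w (Gam : R), 0 <= Gam ->
  (forall x, enorm (mat_word G w *m x) <= Gam * enorm x) ->
  1 <= C * tau ^+ size w * Gam ^+ 2.

Local Notation act w x := (mat_word G w *m x).

Let L0 : 0 < L. Proof. by apply: lt_trans L1. Qed.

Lemma wedge_act w x y : `|wedge (act w x) (act w y)| = `|wedge x y|.
Proof.
elim: w => [|i w IH]; first by rewrite !act_nil.
by rewrite !act_cons wedge_mulmx normrM Gdet mul1r.
Qed.

Lemma act_le w x : enorm (act w x) <= L ^+ size w * enorm x.
Proof.
elim: w => [|i w IH]; first by rewrite act_nil expr0 mul1r.
rewrite act_cons exprS -mulrA; apply: le_trans (GL _ _) _.
by rewrite ler_pM2l.
Qed.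

Lemma act_ge w x : enorm x <= L ^+ size w * enorm (act w x).
Proof.
elim: w => [|i w IH]; first by rewrite act_nil expr0 mul1r.
rewrite act_cons exprSr -mulrA; apply: le_trans IH _.
by rewrite ler_pM2l ?exprn_gt0.
Qed.

Lemma act_neq0 w x : x != 0 -> act w x != 0.
Proof.
rewrite -!enorm_gt0 => x0; have := lt_le_trans x0 (act_ge w x).
by rewrite pmulr_rgt0 // exprn_gt0.
Qed.

(* Writing [y = t x + r] with [r] orthogonal to [x], one step of the orbit changes [t] by at
   most [L |wedge x y| / (|x| |G x|)], since [|r| |x| = |wedge x y|] is invariant. *)
Lemma shear_bound w x y m : 0 < m ->
  (forall k, m <= enorm (act (drop k w) x)) ->
  `|dot2 (act w y) (act w x) / enorm (act w x) ^+ 2 - dot2 y x / enorm x ^+ 2|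
    <= (size w)%:R * (L * `|wedge x y| / m ^+ 2).
Proof.
move=> m0; elim: w => [|i w IH] hm; first by rewrite !act_nil subrr normr0 mul0r.
have {}IH := IH (fun k => hm k.+1).
have hw := hm 1%N; rewrite /= drop0 in hw.
have hi := hm 0%N; rewrite drop0 in hi.
move: IH hw hi; rewrite !act_cons; have := wedge_act w x y.
set X := act w x; set Y := act w y => eW IH hw hi.
set t := dot2 Y X / _ in IH; set t0 := dot2 y x / _ in IH *.
set X' := G i *m X in hi *.
have X0 : 0 < enorm X by apply: lt_le_trans hw.
have X'0 : 0 < enorm X' by apply: lt_le_trans hi.
pose r := Y - t *: X.
have rX : dot2 r X = 0.
  have -> : dot2 r X = dot2 Y X - t * enorm X ^+ 2.
    by rewrite /r enorm_sqr !dot2E !mxE; ring.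
  by rewrite /t divfK ?subrr // sqrf_eq0 gt_eqF.
have rn : enorm r * enorm X = `|wedge x y|.
  apply/eqP; rewrite -(@eqrXn2 _ 2) ?mulr_ge0 ?enorm_ge0 // -eW -lagrange2 rX expr0n /= add0r.
  by rewrite /r wedgeBl wedgeZl wedgexx mulr0 subr0 wedgeC sqrrN real_normK ?num_real.
have e1 : dot2 (G i *m Y) X' / enorm X' ^+ 2 - t = dot2 (G i *m r) X' / enorm X' ^+ 2.
  rewrite /r mulmxBr -scalemxAr -/X'.
  have -> : dot2 (G i *m Y - t *: X') X' = dot2 (G i *m Y) X' - t * enorm X' ^+ 2.
    by rewrite enorm_sqr !dot2E !mxE; ring.
  by rewrite mulrBl mulfK // sqrf_eq0 gt_eqF.
have step : `|dot2 (G i *m Y) X' / enorm X' ^+ 2 - t| <= L * `|wedge x y| / m ^+ 2.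
  rewrite e1 normrM normfV [X in _ / X]ger0_norm ?sqr_ge0 //.
  rewrite ler_pdivrMr ?exprn_gt0 //.
  apply: le_trans (ler_dot2 _ _) _.
  apply: le_trans (_ : L * enorm r * enorm X' <= _).
    by rewrite ler_wpM2r ?enorm_ge0.
  rewrite -rn [leRHS]mulrAC ler_pdivlMr ?exprn_gt0 //.
  have -> : L * (enorm r * enorm X) * enorm X' ^+ 2 = L * enorm r * enorm X' * (enorm X * enorm X').
    by ring.
  by rewrite ler_wpM2l ?mulr_ge0 ?enorm_ge0 ?(ltW L0) // expr2 ler_pM // ltW.
have := ler_normD (dot2 (G i *m Y) X' / enorm X' ^+ 2 - t) (t - t0).
rewrite addrA subrK => h; apply: le_trans h _.
by rewrite -natr1 mulrDl mul1r [leRHS]addrC lerD.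
Qed.

(** In the basis [x], [rot x]: the first vector is stretched at most by [1 / c], and [shear_bound]
    makes the image of the second at most linear in the length. The operator norm is then at most
    [2 / c + n * (L / c ^+ 3)], which [growth] excludes for large [n]. *)
Lemma no_long_hump (c : R) : 0 < c -> c <= 1 -> exists n0, forall w x, x != 0 ->
  (forall k, c * enorm x <= enorm (act (drop k w) x)) ->
  (forall k, c * enorm (act w x) <= enorm (act (drop k w) x)) ->
  (size w < n0)%N.
Proof.
move=> c0 c1.
have [||n0 hn0] := geometric_vs_square (a := 2 / c) (b := L / c ^+ 3) C0 tau01.
- by rewrite divr_gt0.
- by rewrite divr_gt0 // exprn_gt0.
exists n0 => w x x0 h1 h2; rewrite ltnNge; apply/negP => /hn0; apply/negP; rewrite -leNgt.
have {}x0 : 0 < enorm x by rewrite enorm_gt0.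
set n := (size w)%:R : R.
have n0' : 0 <= n by [].
apply: growth => [|z]; first by rewrite addr_ge0 ?mulr_ge0 ?invr_ge0 ?exprn_ge0 ?(ltW c0) ?(ltW L0).
set p := enorm x in x0 h1 *.
have y1 := h1 0%N; have x1 := h2 (size w); rewrite drop0 in y1; rewrite drop_size act_nil -/p in x1.
set q := enorm (act w x) in h2 x1 y1.
have q0 : 0 < q by apply: lt_le_trans y1; rewrite mulr_gt0.
have cp0 : 0 < c * p by rewrite mulr_gt0.
have := shear_bound (rot x) cp0 h1.
rewrite wedge_rot -/p -/q.
have -> : dot2 (rot x) x = 0 by rewrite dot2rotl wedgexx.
rewrite mul0r subr0 -/n (ger0_norm (sqr_ge0 p)).
have -> : L * p ^+ 2 / (c * p) ^+ 2 = L / c ^+ 2 by field; rewrite !gt_eqF.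
set t := dot2 _ _ / _ => ht.
have dec : act w (rot x) = t *: act w x + (wedge (act w x) (act w (rot x)) / q ^+ 2) *: rot (act w x).
  apply: (@scalerI _ _ (q ^+ 2)); first by rewrite sqrf_eq0 gt_eqF.
  rewrite rot_decomp scalerDr !scalerA; congr (_ *: _ + _ *: _);
    by rewrite [RHS]mulrC divfK // sqrf_eq0 gt_eqF.
have ny : enorm (act w (rot x)) <= (n * (L / c ^+ 3) + 1 / c) * p.
  rewrite dec; apply: le_trans (ler_enormD _ _) _.
  have eW : `|wedge (act w x) (act w (rot x)) / q ^+ 2| = p ^+ 2 / q ^+ 2.
    by rewrite normrM wedge_act wedge_rot -/p normfV !ger0_norm ?sqr_ge0.
  rewrite !enormZ enorm_rot -/q eW mulrDl; apply: lerD.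
    apply: le_trans (_ : n * (L / c ^+ 2) * q <= _); first by rewrite ler_pM2r.
    have -> : n * (L / c ^+ 3) * p = n * (L / c ^+ 2) * (p / c) by field; rewrite gt_eqF.
    rewrite ler_wpM2l ?mulr_ge0 ?invr_ge0 ?sqr_ge0 ?(ltW L0) //.
    by rewrite ler_pdivlMr // mulrC.
  have -> : p ^+ 2 / q ^+ 2 * q = p * (p / q) by field; rewrite gt_eqF.
  rewrite mulrC ler_pM2r // ler_pdivrMr // div1r mulrC ler_pdivlMr // mulrC //.
have nx : q <= 1 / c * p by rewrite div1r mulrC ler_pdivlMr // mulrC.
have : enorm (act w (p ^+ 2 *: z)) <= enorm z * p * (2 / c + n * (L / c ^+ 3)) * p.
  rewrite rot_decomp mulmxDr -!scalemxAr; apply: le_trans (ler_enormD _ _) _.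
  rewrite !enormZ -/q.
  have d1 := ler_dot2 z x; have d2 := ler_wedge x z; rewrite -/p in d1 d2.
  rewrite mulrC in d2.
  have -> : enorm z * p * (2 / c + n * (L / c ^+ 3)) * p
     = enorm z * p * (1 / c * p) + enorm z * p * ((n * (L / c ^+ 3) + 1 / c) * p).
    by field; rewrite gt_eqF.
  by apply: lerD; apply: ler_pM => //; exact: enorm_ge0.
rewrite -scalemxAr enormZ ger0_norm ?sqr_ge0 //.
have -> : enorm z * p * (2 / c + n * (L / c ^+ 3)) * p =
  p ^+ 2 * ((2 / c + n * (L / c ^+ 3)) * enorm z) by ring.
by rewrite ler_pM2l // exprn_gt0.
Qed.

(** Letters act from the right, so suffixes of [w] are times along the orbit. The suffix [s] ends at
    the last time the norm is at most [th]; one letter changes norms by a factor of at most [L], so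
    the norm is then still at least [th / L]. *)
Lemma split_first_exit w z th : enorm z <= th -> th < enorm (act w z) ->
  exists p s, [/\ w = p ++ s, enorm (act s z) <= th, th <= L * enorm (act s z) &
    forall k, (k < size p)%N -> th < enorm (act (drop k p) (act s z))].
Proof.
move=> hz; elim: w => [|i w IH] hw; first by move: hw; rewrite act_nil ltNge hz.
have [le|lt] := leP (enorm (act w z)) th.
  exists [:: i], w; split => //.
    by apply: le_trans (ltW hw) _; rewrite act_cons.
  by case=> //= _; rewrite mulmx1 -act_cons.
have [p [s [e h1 h2 h3]]] := IH lt.
exists (i :: p), s; split => //; first by rewrite e.
case=> [_|k hk]; last exact: h3.
by rewrite drop0 -act_cat cat_cons -e.
Qed.

(** The counterpart in the other time direction: [s] ends at the first time the norm is at most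
    [th], if there is one. *)
Lemma split_first_entry w y th : th < enorm y ->
  (forall k, th < enorm (act (drop k w) y)) \/
  exists p s, [/\ w = p ++ s, enorm (act s y) <= th, th <= L * enorm (act s y) &
    forall k, (0 < k)%N -> th < enorm (act (drop k s) y)].
Proof.
move=> hy; elim: w => [|i w [IH|[p [s [e h1 h2 h3]]]]].
- by left => k; rewrite mul1mx.
- have [le|lt] := leP (enorm (act (i :: w) y)) th.
    right; exists [::], (i :: w); split => //; last by case=> // k _; exact: IH.
    by have := IH 0%N; rewrite drop0 act_cons => /ltW h; apply: le_trans h _.
  by left; case=> [|k]; [rewrite drop0 | exact: IH].
- by right; exists (i :: p), s; split => //; rewrite e.
Qed.

(** A point exceeding [K] times both an earlier and a later one would lie on a hump. Between the
    last time before it and the first time after it at which the norm is at most [th], the orbit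
    stays at least [th / L], so [no_long_hump] makes the hump shorter than [n0]; but climbing from
    [th] to [K * th] takes more than [n0] letters by the choice of [K]. *)
Lemma orbit_quasiconvex : exists2 K, 1 <= K & forall w1 w2 z,
  enorm (act w2 z) <= K * enorm z \/
  enorm (act w2 z) <= K * enorm (act w1 (act w2 z)).
Proof.
have Li : L^-1 <= 1 by rewrite invf_le1 // ltW.
have [|n0 hn0] := @no_long_hump L^-1 _ Li; first by rewrite invr_gt0.
exists (L ^+ n0.+1) => [|w1 w2 z]; first by rewrite exprn_ege1 // ltW.
set K := L ^+ _; have K1 : 1 < K by rewrite exprn_egt1.
have K0 : 0 < K by apply: lt_trans K1.
have [|hz] := leP; first by left.
have [|hw] := leP; first by right.
exfalso; set y := act w2 z in hz hw.
pose th := enorm y / K.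
have thz : enorm z < th by rewrite ltr_pdivlMr // mulrC.
have thw : enorm (act w1 y) < th by rewrite ltr_pdivlMr // mulrC.
have th0 : 0 < th by apply: le_lt_trans thz; exact: enorm_ge0.
have y0 : 0 < enorm y by rewrite -(pmulr_lgt0 _ (_ : 0 < K^-1)) // invr_gt0.
have thy : th < enorm y by rewrite ltr_pdivrMr // ltr_pMr.
have [p [s [ew2 s1 s2 s3]]] := split_first_exit (ltW thz) thy.
have [/(_ 0%N)|[p' [s' [ew1 t1 t2 t3]]]] := split_first_entry w1 thy.
  by rewrite drop0 ltNge ltW.
set x := act s z in s1 s2 s3.
have eyx : y = act p x by rewrite /y ew2 act_cat.
have x0 : x != 0.
  by rewrite -enorm_gt0; have := lt_le_trans th0 s2; rewrite pmulr_rgt0.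
have low k : L^-1 * th <= enorm (act (drop k (s' ++ p)) x).
  rewrite mulrC ler_pdivrMr // mulrC drop_cat; case: ltnP => hk.
    rewrite act_cat -eyx; case: k hk => [|k] hk; first by rewrite drop0.
    apply: le_trans (ltW (t3 k.+1 _)) _ => //.
    by rewrite ler_peMl ?enorm_ge0 // ltW.
  set j := (k - _)%N; have [lj|lj] := ltnP j (size p).
    apply: le_trans (ltW (s3 j lj)) _.
    by rewrite ler_peMl ?enorm_ge0 // ltW.
  by rewrite drop_oversize // act_nil.
have Lth : 0 < L^-1 by rewrite invr_gt0.
have : (size (s' ++ p) < n0)%N.
  apply: hn0 x0 _ _ => k; apply: le_trans (low k); rewrite ler_pM2l //.
  by rewrite act_cat -eyx.
have : (n0 < size p)%N.
  rewrite -(ler_eXn2l L1).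
  have := act_le p x; rewrite -eyx => h.
  have : enorm y <= L ^+ size p * th.
    by apply: le_trans h _; rewrite ler_pM2l ?exprn_gt0.
  by rewrite /th mulrCA ler_pMr // ler_pdivlMr // mul1r.
rewrite size_cat => h1 h2.
have := leq_trans h2 (ltnW h1); rewrite ltnNge leq_addl //.
Qed.

Lemma act_surj w y : exists x, act w x = y.
Proof.
suff u : mat_word G w \in unitmx by exists (invmx (mat_word G w) *m y); rewrite mulKVmx.
elim: w => [|i w IH]; first exact: unitmx1.
rewrite /= unitmx_mul IH andbT unitmxE unitfE -normr_gt0 Gdet //.
Qed.

(** Since [b = act h z] and [rot b] span the plane, [w] expands [b] comparably to its norm once the
    image of [rot b] is at most a constant times that of [b]. That bound comes from quasi-convexity
    applied to a combination [e] of the two vectors whose image is short. *)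
Lemma grown_vector_growth : exists k d : R, [/\ 0 < k, 0 < d & forall h z w x,
  z != 0 -> enorm z <= d * enorm (act h z) ->
  k * (enorm (act w x) * enorm (act h z)) <= enorm (act w (act h z)) * enorm x].
Proof.
have [K K1 qc] := orbit_quasiconvex.
have K0 : 0 < K by apply: lt_le_trans K1.
(* With [K * d] equal to one half, a vector grown by the factor [1 / d] fails the first alternative
   of quasi-convexity, so the second one holds. *)
pose d := (2 * K)^-1.
have d0 : 0 < d by rewrite invr_gt0 mulr_gt0.
have Kd : K * d = 2^-1 by rewrite /d; field; rewrite gt_eqF.
have d1 : d < 1 by rewrite invf_lt1 ?mulr_gt0 //; lra.
have dL : d / L <= 1 by rewrite ler_pdivrMr // mul1r (le_trans (ltW d1)) // ltW.
have [|n0 hn0] := no_long_hump _ dL; first by rewrite divr_gt0.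
pose K3 := 2 * K * L ^+ n0 + K * K.
have Ln0 : 0 < L ^+ n0 by rewrite exprn_gt0.
have K30 : 0 < K3 by rewrite addr_gt0 // !mulr_gt0.
exists (1 + K3)^-1, d; split => //; first by rewrite invr_gt0; lra.
move=> h z w x z0 hz; set b := act h z in hz *; set B := enorm b in hz *.
have B0 : 0 < B by rewrite enorm_gt0 act_neq0.
set mu := enorm (act w b).
have muB : B <= K * mu.
  case: (qc w h z) => // hB; exfalso; have : B <= K * (d * B).
    by apply: le_trans hB _; rewrite ler_pM2l.
  by rewrite mulrA Kd; lra.
have mu0 : 0 < mu by rewrite enorm_gt0 !act_neq0.
pose f := rot b; set nu := enorm (act w f).
have fB : enorm f = B by rewrite enorm_rot.
have nu0 : 0 < nu by rewrite enorm_gt0 act_neq0 // -enorm_gt0 fB.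
have numu : nu <= K3 * mu.
  have dB : d * B < B by rewrite gtr_pMl.
  (* [p] is the final climb of the orbit from level [d * B] to [B]. Its length is bounded by
     [no_long_hump], hence so is the preimage [g] of [f] under it. *)
  have [p [s [eh s1 s2 s3]]] := split_first_exit hz dB.
  have sp : (size p < n0)%N.
    apply: (hn0 p (act s z)) => [|k|k]; first by rewrite act_neq0.
      have [lk|lk] := ltnP k (size p).
        apply: le_trans (ltW (s3 k lk)); apply: le_trans s1.
        by rewrite ler_piMl ?enorm_ge0.
      by rewrite drop_oversize // act_nil ler_piMl ?enorm_ge0.
    rewrite -act_cat -eh -/b -/B mulrAC ler_pdivrMr // mulrC.
    have [lk|lk] := ltnP k (size p).
      apply: le_trans (_ : d * B <= _); first by rewrite mulrC.
      apply: le_trans (ltW (s3 k lk)) _; by rewrite ler_peMr ?enorm_ge0 // ltW.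
    by rewrite drop_oversize // act_nil mulrC [leRHS]mulrC.
  have [g eg] := act_surj p f.
  have gB : enorm g <= L ^+ n0 * B.
    apply: le_trans (act_ge p g) _; rewrite eg fB ler_pM2r //.
    by rewrite ler_eXn2l // ltnW.
  (* This [t] makes the image of [e = b - t *: f] orthogonal to that of [f]. By invariance of the
     wedge, the image of [e] has norm at most [B ^+ 2 / nu], while [e] is no shorter than [b]. *)
  pose t := dot2 (act w b) (act w f) / nu ^+ 2.
  have tn : `|t| <= mu / nu.
    rewrite /t normrM normfV (ger0_norm (sqr_ge0 nu)) ler_pdivrMr ?exprn_gt0 //.
    have -> : mu / nu * nu ^+ 2 = mu * nu by field; rewrite gt_eqF.
    exact: ler_dot2.
  pose e := b - t *: f.
  have ez : e = act p (act s z - t *: g).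
    by rewrite mulmxBr -scalemxAr eg -act_cat -eh.
  have Be : B <= enorm e.
    rewrite -(@ler_pXn2r _ 2) ?nnegrE ?enorm_ge0 //.
    have -> : enorm e ^+ 2 = B ^+ 2 + (t * B) ^+ 2.
      by rewrite exprMn /B /e !enorm_sqr !mxE /=; ring.
    by rewrite lerDl sqr_ge0.
  have we : enorm (act w e) * nu <= B ^+ 2.
    have dt : dot2 (act w e) (act w f) = 0.
      have -> : dot2 (act w e) (act w f) = dot2 (act w b) (act w f) - t * nu ^+ 2.
        by rewrite /e mulmxBr -scalemxAr /nu enorm_sqr !dot2E !mxE; ring.
      by rewrite /t divfK ?subrr // sqrf_eq0 gt_eqF.
    rewrite -(@ler_pXn2r _ 2) ?nnegrE ?mulr_ge0 ?enorm_ge0 ?sqr_ge0 //.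
    rewrite -lagrange2 dt expr0n /= add0r -(real_normK (num_real (wedge _ _))) wedge_act.
    rewrite /e wedgeBl wedgeZl wedgexx mulr0 subr0 wedge_rot ger0_norm //.
    exact: sqr_ge0.
  (* If [e] is controlled by its past, then [t] cannot be small, whereas [t] is at most [mu / nu].
     If it is controlled by its future, then [nu] is at most [K * B], hence at most [K * K * mu]. *)
  have [h1|h1] := qc w p (act s z - t *: g); rewrite -ez in h1.
    have {}h1 : B <= K * (d * B + mu / nu * (L ^+ n0 * B)).
      apply: le_trans Be _; apply: le_trans h1 _; rewrite ler_pM2l //.
      apply: le_trans (ler_enormB _ _) _; rewrite enormZ; apply: lerD => //.
      by apply: ler_pM => //; exact: enorm_ge0.
    have {}h1 : 2^-1 * B <= (K * (mu / nu) * L ^+ n0) * B.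
      rewrite mulrDr (mulrA K d) Kd (mulrA K (mu / nu)) (mulrA _ (L ^+ n0)) in h1.
      by move: (K * _ * _ * _) h1 => Z; lra.
    rewrite ler_pM2r // in h1.
    have : nu <= 2 * K * L ^+ n0 * mu.
      have e2 : K * (mu / nu) * L ^+ n0 = (K * L ^+ n0 * mu) / nu by ring.
      by move: h1; rewrite e2 ler_pdivlMr //; lra.
    by move=> h2; apply: le_trans h2 _; rewrite /K3 [leRHS]mulrDl lerDl !mulr_ge0 // ltW.
  have h2 : nu <= K * B.
    rewrite -(ler_pM2l B0); apply: le_trans (_ : K * enorm (act w e) * nu <= _).
      by rewrite ler_pM2r // (le_trans Be).
    by rewrite -mulrA [leRHS]mulrCA -expr2 ler_pM2l.
  have h3 : nu <= K * K * mu by apply: le_trans h2 _; rewrite -mulrA ler_pM2l.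
  by apply: le_trans h3 _; rewrite /K3 [leRHS]mulrDl lerDr !mulr_ge0 // ltW.
rewrite -/mu mulrC ler_pdivrMr; last lra.
have : enorm (act w (B ^+ 2 *: x)) <= enorm x * B * (mu + nu).
  rewrite rot_decomp mulmxDr -!scalemxAr; apply: le_trans (ler_enormD _ _) _.
  rewrite !enormZ -/mu -/f -/nu mulrDr.
  have d2 := ler_wedge b x; rewrite mulrC in d2.
  by apply: lerD; rewrite ler_pM2r //; exact: ler_dot2.
rewrite -scalemxAr enormZ ger0_norm ?sqr_ge0 //.
have -> : B ^+ 2 * enorm (act w x) = B * (enorm (act w x) * B) by ring.
have -> : enorm x * B * (mu + nu) = B * (enorm x * (mu + nu)) by ring.
rewrite ler_pM2l // => h1.
apply: le_trans h1 _.
have -> : mu * enorm x * (1 + K3) = enorm x * (mu + K3 * mu) by ring.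
by rewrite ler_wpM2l ?enorm_ge0 // lerD2l.
Qed.

Lemma limit_dir_act b w : limit_dir G b -> limit_dir G (act w b).
Proof.
move=> [b0 [a a0 hb]]; split; first exact: act_neq0.
exists a => // e e0; have Lw : 0 < L ^+ size w by rewrite exprn_gt0.
have [c [u hu]] := hb (e / L ^+ size w) (divr_gt0 e0 Lw).
exists c, (w ++ u) => x; rewrite act_cat (scalemxAr c) (scalemxAr (dot2 a x)) -mulmxBr.
apply: le_trans (act_le _ _) _; apply: le_trans (_ : L ^+ size w * (e / L ^+ size w * enorm x) <= _).
  by rewrite ler_pM2l.
by rewrite mulrA [_ * (e / _)]mulrC divfK // gt_eqF.
Qed.

(** Take [u] with [c *: act u] close to the rank one map. It sends [a] near a multiple of [b] and
    nearly kills [rot a]; invariance of area then makes [z = c *: a] much shorter than its image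
    under [u], so [grown_vector_growth] applies to that image. The inequality for [b] follows as the
    error tends to 0. *)
Lemma limit_dir_growth : exists2 k : R, 0 < k & forall b, limit_dir G b -> forall w x,
  k * (enorm (act w x) * enorm b) <= enorm (act w b) * enorm x.
Proof.
have [k [d [k0 d0 hk]]] := grown_vector_growth.
exists k => // b [b0 [a a0 hb]] w x.
rewrite -enorm_gt0 in b0.
set na := enorm a; have na0 : 0 < na by rewrite enorm_gt0.
pose M := k * enorm (act w x) * na + L ^+ size w * na * enorm x.
have M0 : 0 <= M.
  by rewrite addr_ge0 // !mulr_ge0 ?enorm_ge0 ?exprn_ge0 // ltW.
suff h : exists2 e0 : R, 0 < e0 & forall e, 0 < e -> e <= e0 ->
    na ^+ 2 * (k * (enorm (act w x) * enorm b)) <= na ^+ 2 * (enorm (act w b) * enorm x) + e * M.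
  have [e1 e10 {}h] := h.
  rewrite -(ler_pM2l (exprn_gt0 2 na0)); apply/ler_addgt0Pr => e e0.
  pose e2 := Num.min e1 (e / (M + 1)).
  have M1 : 0 < M + 1 by lra.
  have e20 : 0 < e2 by rewrite lt_min e10 divr_gt0.
  apply: le_trans (h e2 e20 _) _; first by rewrite ge_min lexx.
  rewrite lerD2l; apply: le_trans (_ : e / (M + 1) * (M + 1) <= _); last by rewrite divfK // gt_eqF.
  by apply: ler_pM => //; [exact: ltW | rewrite ge_min lexx orbT | lra].
pose nb := na ^+ 2 * enorm b; have nb0 : 0 < nb by rewrite mulr_gt0 // exprn_gt0.
pose T := d * (nb / 2); have T0 : 0 < T by rewrite mulr_gt0 // divr_gt0.
pose e1 := Num.min (na * enorm b / 2) (T ^+ 2 / (2 * nb * na)).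
have e10 : 0 < e1.
  by rewrite lt_min !divr_gt0 ?exprn_gt0 // ?mulr_gt0.
exists e1 => // e e0; rewrite le_min => /andP[ee1 ee2].
have [c [u hu]] := hb e e0.
pose z := c *: a; have ez : act u z = c *: act u a by rewrite /z -scalemxAr.
have ha : enorm (act u z - na ^+ 2 *: b) <= e * na.
  by have := hu a; rewrite ez dot2xx.
have lo : nb - e * na <= enorm (act u z).
  have := ler_enorm_sub (na ^+ 2 *: b) (act u z).
  by rewrite enormB enormZ ger0_norm ?sqr_ge0 // -/nb; lra.
have hi : enorm (act u z) <= nb + e * na.
  have := ler_enorm_sub (act u z) (na ^+ 2 *: b).
  by rewrite enormZ ger0_norm ?sqr_ge0 // -/nb; lra.
have ena : e * na <= nb / 2.
  by have := ler_wpM2r (ltW na0) ee1; rewrite /nb expr2; lra.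
have z0 : z != 0.
  by apply/eqP => z0; move: lo; rewrite z0 mulmx0 enorm0; lra.
have cz : (`|c| * na) ^+ 2 <= T ^+ 2.
  have h1 := hu (rot a); rewrite dot2_rot scale0r subr0 enorm_rot -/na scalemxAr in h1.
  have : `|wedge (act u z) (act u (c *: rot a))| <= (nb + e * na) * (e * na).
    by apply: le_trans (ler_wedge _ _) _; apply: ler_pM => //; exact: enorm_ge0.
  rewrite wedge_act wedgeZl wedgeZr wedge_rot -/na.
  have -> : `|c * (c * na ^+ 2)| = (`|c| * na) ^+ 2.
    by rewrite mulrA -expr2 -exprMn normrX normrM (gtr0_norm na0).
  move=> h2; apply: le_trans h2 _.
  have h3 : (nb + e * na) * (e * na) <= (2 * nb) * (e * na).
    by rewrite ler_pM2r ?mulr_gt0 //; lra.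
  apply: le_trans h3 _.
  have -> : 2 * nb * (e * na) = e * (2 * nb * na) by ring.
  by rewrite -ler_pdivlMr // !mulr_gt0.
have zd : enorm z <= d * enorm (act u z).
  rewrite /z enormZ -/na.
  have {}cz : `|c| * na <= T.
    by rewrite -(@ler_pXn2r _ 2) ?nnegrE ?(ltW T0) ?mulr_ge0 ?(ltW na0).
  by apply: le_trans cz _; rewrite /T ler_pM2l //; lra.
have l0 := hk u z w x z0 zd.
have l1 : enorm (act w (act u z)) <= na ^+ 2 * enorm (act w b) + L ^+ size w * (e * na).
  have := ler_enorm_sub (act w (act u z)) (act w (na ^+ 2 *: b)).
  rewrite -mulmxBr -(scalemxAr (na ^+ 2)) enormZ ger0_norm ?sqr_ge0 // => h1.
  have h2 := act_le w (act u z - na ^+ 2 *: b).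
  have h3 : L ^+ size w * enorm (act u z - na ^+ 2 *: b) <= L ^+ size w * (e * na).
    by rewrite ler_pM2l // exprn_gt0.
  lra.
have l2 := ler_wpM2r (enorm_ge0 x) l1.
have kw : 0 <= k * enorm (act w x) by rewrite mulr_ge0 ?enorm_ge0 // ltW.
have l3 := ler_wpM2l kw lo.
rewrite /M /nb in l3 *; move: l0 l2 l3.
move: (enorm (act w x)) (enorm b) (enorm (act u z)) (enorm (act w (act u z))) (enorm (act w b)).
move: (L ^+ _) (enorm x) => *; lra.
Qed.

(** Let [w] approximate the rank one map with image [b]. By [limit_dir_growth] no Furstenberg
    direction [b'] is close to the kernel of that map, so its image is close to a nonzero multiple
    of [b], with the same [w] for all [b']. *)
Lemma steering b e : limit_dir G b -> 0 < e -> exists w, forall b', limit_dir G b' ->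
  exists2 t, t != 0 & enorm (t *: act w b' - b) <= e.
Proof.
move=> [b0 [a a0 hb]] e0; have [k k0 hk] := limit_dir_growth.
rewrite -enorm_gt0 in b0.
set na := enorm a; have na0 : 0 < na by rewrite enorm_gt0.
(* The first bound makes [dot2 a b'] at least [k / 2] times the product of the norms of [a] and
   [b']; the second turns this into the final error [e]. *)
pose f := Num.min (k * na * enorm b / (2 * (k + 1))) (e * (k * na / 2)).
have k10 : 0 < 2 * (k + 1) by lra.
have f0 : 0 < f.
  rewrite lt_min; apply/andP; split; first by rewrite divr_gt0 // !mulr_gt0.
  by rewrite mulr_gt0 // divr_gt0 // mulr_gt0.
have [c [w hw]] := hb f f0.
have : f <= f by []. rewrite {2}/f le_min => /andP[f1 f2].
exists w => b' hb'; have := hk _ hb' w a; rewrite -/na.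
have b'0 : 0 < enorm b' by rewrite enorm_gt0; case: hb'.
set nb' := enorm b' => hg.
have lo : na ^+ 2 * enorm b - f * na <= `|c| * enorm (act w a).
  have := hw a; have := ler_enorm_sub (na ^+ 2 *: b) (c *: act w a).
  rewrite enormB enormZ ger0_norm ?sqr_ge0 // dot2xx enormZ -/na; lra.
have hi : `|c| * enorm (act w b') <= `|dot2 a b'| * enorm b + f * nb'.
  have := hw b'; have := ler_enorm_sub (c *: act w b') (dot2 a b' *: b).
  rewrite !enormZ -/nb'; lra.
have fk : f * (k + 1) <= k * na * enorm b / 2.
  move: f1; rewrite ler_pdivlMr //; lra.
have key : k * na / 2 * nb' <= `|dot2 a b'|.
  have g1 := ler_wpM2l (normr_ge0 c) hg.
  have g2 := ler_wpM2l (mulr_ge0 (ltW k0) (ltW b'0)) lo.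
  have g3 := ler_wpM2r (ltW na0) hi.
  have g4 := ler_wpM2r (mulr_ge0 (ltW na0) (ltW b'0)) fk.
  rewrite -(ler_pM2r (mulr_gt0 na0 b0)).
  move: g1 g2 g3 g4; rewrite -/nb'.
  move: (enorm (act w a)) (enorm (act w b')) (enorm b) `|c| `|dot2 a b'| => *; lra.
have d0 : 0 < `|dot2 a b'|.
  by apply: lt_le_trans key; rewrite mulr_gt0 // divr_gt0 // mulr_gt0.
have c0 : c != 0.
  apply/eqP => c0; move: hi lo; rewrite c0 normr0 !mul0r => _ lo.
  have nab : 0 < na * enorm b by rewrite mulr_gt0.
  have h1 : na * enorm b <= f.
    by rewrite -(ler_pM2r na0); rewrite expr2 in lo; lra.
  have h2 : na * enorm b * (k + 1) <= f * (k + 1) by rewrite ler_pM2r //; lra.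
  have h3 : 0 < k * (na * enorm b) by rewrite mulr_gt0.
  lra.
exists (c / dot2 a b').
  by rewrite mulf_neq0 // invr_eq0 -normr_gt0.
have -> : (c / dot2 a b') *: act w b' - b = (dot2 a b')^-1 *: (c *: act w b' - dot2 a b' *: b).
  by rewrite scalerBr !scalerA mulVf -?normr_gt0 // scale1r mulrC.
rewrite enormZ normfV mulrC ler_pdivrMr //; apply: le_trans (hw b') _.
apply: le_trans (_ : e * (k * na / 2 * nb') <= _); last by rewrite ler_pM2l.
by rewrite mulrA ler_pM2r.
Qed.

End Cocycle.

(** * Normalised adjugates and Furstenberg directions *)

Section SingularValues.
Variable R : realType.
Implicit Types (x y z : 'cV[R]_2) (A : 'M[R]_2).

Let e1 : 'cV[R]_2 := \col_i (i == 0)%:R.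

Lemma enorm_e1 : enorm e1 = 1.
Proof.
apply/eqP; rewrite -(@eqrXn2 _ 2) ?enorm_ge0 // enorm_sqr !mxE /=.
by rewrite expr0n addr0.
Qed.

Lemma alpha1_ub A x : enorm (A *m x) <= alpha1 A * enorm x.
Proof.
have [->|x0] := eqVneq x 0; first by rewrite mulmx0 enorm0 mulr0.
rewrite -enorm_gt0 in x0; rewrite -ler_pdivrMr // mulrC.
have -> : (enorm x)^-1 * enorm (A *m x) = enorm (A *m ((enorm x)^-1 *: x)).
  by rewrite -scalemxAr enormZ gtr0_norm ?invr_gt0.
have [L L0 hL] := mulmx_bounded A.
apply: ub_le_sup.
  by exists L => _ [y /= y1 <-]; apply: le_trans (hL y) _; rewrite y1 mulr1.
by exists ((enorm x)^-1 *: x) => //=; rewrite enormZ gtr0_norm ?invr_gt0 // mulVf // gt_eqF.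
Qed.

Lemma alpha1_le A m : (forall x, enorm (A *m x) <= m * enorm x) -> alpha1 A <= m.
Proof.
move=> h; apply: ge_sup; first by exists (enorm (A *m e1)), e1 => //=; exact: enorm_e1.
by move=> _ [y /= y1 <-]; apply: le_trans (h y) _; rewrite y1 mulr1.
Qed.

Lemma alpha2_ge A m : (forall x, m * enorm x <= enorm (A *m x)) -> m <= alpha2 A.
Proof.
move=> h; apply: lb_le_inf; first by exists (enorm (A *m e1)), e1 => //=; exact: enorm_e1.
by move=> _ [y /= y1 <-]; apply: le_trans (h y); rewrite y1 mulr1.
Qed.

End SingularValues.

Lemma fin_uniform_bound (R : realType) N (P : 'I_N -> R -> Prop) :
  (forall i, exists l, forall l', l <= l' -> P i l') -> exists2 l, 1 < l & forall i, P i l.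
Proof.
move/choice => [l hl]; exists (2 + \sum_i `|l i|) => [|i].
  by apply: lt_le_trans (_ : 2 <= _); [lra | rewrite lerDl sumr_ge0].
apply: hl; apply: le_trans (ler_norm _) _; rewrite (bigD1 i) //= addrCA lerDl.
by rewrite addr_ge0 // sumr_ge0.
Qed.

Section Normalized.
Variables (R : realType) (N : nat) (A : 'I_N -> 'M[R]_2).
Hypothesis unitA : forall i, A i \in unitmx.
Implicit Types (x y z b : 'cV[R]_2) (w : seq 'I_N).

Definition qdet i : R := Num.sqrt `|\det (A i)|.

(* The adjugate of [A i], normalised to have determinant of modulus one. *)
Definition nadj i : 'M[R]_2 := (\det (A i) / qdet i) *: invmx (A i).

Definition qword w : R := \prod_(i <- w) qdet i.

Let detA i : \det (A i) != 0.
Proof. by have := unitA i; rewrite unitmxE unitfE. Qed.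

Lemma qdet_gt0 i : 0 < qdet i.
Proof. by rewrite sqrtr_gt0 normr_gt0. Qed.

Lemma qword_gt0 w : 0 < qword w.
Proof. by apply: prodr_gt0 => i _; exact: qdet_gt0. Qed.

Lemma qword_cat u w : qword (u ++ w) = qword u * qword w.
Proof. by rewrite /qword big_cat. Qed.

Lemma nadj_det i : `|\det (nadj i)| = 1.
Proof.
rewrite /nadj detZ det_inv normrM normrX normrM !normfV.
have q2 : qdet i ^+ 2 = `|\det (A i)| by rewrite sqr_sqrtr.
rewrite (gtr0_norm (qdet_gt0 i)) expr_div_n q2.
have : `|\det (A i)| != 0 by rewrite normr_eq0.
by move: `|_| => d d0; field.
Qed.

Lemma wedge_nadj i b z : wedge b (A i *m z) = qdet i * wedge (nadj i *m b) z.
Proof.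
rewrite -{1}(mulKVmx (unitA i) b) wedge_mulmx /nadj -scalemxAl wedgeZl mulrA.
by rewrite mulrCA divff ?mulr1 // gt_eqF ?qdet_gt0.
Qed.

Lemma wedge_word w b z :
  wedge b (mat_word A w *m z) = qword w * wedge (mat_word nadj (rev w) *m b) z.
Proof.
elim: w b => [|i w IH] b; first by rewrite !act_nil /qword big_nil mul1r.
by rewrite act_cons wedge_nadj IH rev_cons act_rcons /qword big_cons mulrA.
Qed.

Lemma nadj_bounds : exists2 L, 1 < L & forall i,
  [/\ forall x, enorm (nadj i *m x) <= L * enorm x,
      forall x, enorm x <= L * enorm (nadj i *m x) & L^-1 <= qdet i].
Proof.
apply: fin_uniform_bound => i.
have [L1 L10 h1] := mulmx_bounded (nadj i).
have [L2 L20 h2] := mulmx_bounded (invmx (nadj i)).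
have u : nadj i \in unitmx by rewrite unitmxE unitfE -normr_gt0 nadj_det.
have q0 := qdet_gt0 i.
exists (L1 + L2 + (qdet i)^-1) => L' hL.
have qi0 : 0 < (qdet i)^-1 by rewrite invr_gt0.
split=> [x|x|].
- by apply: le_trans (h1 x) _; rewrite ler_wpM2r ?enorm_ge0 //; lra.
- have := h2 (nadj i *m x); rewrite mulKmx // => h; apply: le_trans h _.
  by rewrite ler_wpM2r ?enorm_ge0 //; lra.
- by rewrite -[leRHS]invrK lef_pV2 ?posrE //; lra.
Qed.

Lemma contraction_bound : (forall i, alpha1 (A i) < 1) ->
  exists2 a, 0 < a < 1 & forall i x, enorm (A i *m x) <= a * enorm x.
Proof.
move=> h1; have [|l l1 hl] := @fin_uniform_bound R N
  (fun i l => forall x, enorm (A i *m x) <= (1 - l^-1) * enorm x).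
  move=> i; exists (1 - alpha1 (A i))^-1 => l hl x.
  have s0 : 0 < 1 - alpha1 (A i) by rewrite subr_gt0.
  apply: le_trans (alpha1_ub _ _) _; rewrite ler_wpM2r ?enorm_ge0 //.
  have : l^-1 <= 1 - alpha1 (A i).
    by rewrite -[leRHS]invrK lef_pV2 ?posrE ?invr_gt0 // (lt_le_trans _ hl) // invr_gt0.
  lra.
have l0 : 0 < l by lra.
have li : 0 < l^-1 by rewrite invr_gt0.
have li1 : l^-1 < 1 by rewrite invf_lt1.
by exists (1 - l^-1) => //; lra.
Qed.

(** By duality the product of the [A i] along [rev w] has norm at most [D * Gam]. The normalised
    product has determinant of modulus one, so its inverse also has norm at most [Gam], and [alpha2]
    is at least [D / Gam]. Domination compares the two bounds. *)
Lemma dominated_growth : dominated A -> exists C tau, [/\ 0 < C, 0 < tau < 1 &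
  forall w (Gam : R), 0 <= Gam ->
    (forall x, enorm (mat_word nadj w *m x) <= Gam * enorm x) ->
    1 <= C * tau ^+ size w * Gam ^+ 2].
Proof.
move=> [C [tau [C0 [tau01 hd]]]]; exists C, tau; split => // w Gam Gam0 hG.
have := hd (rev w); rewrite size_rev; set D := qword (rev w).
have D0 : 0 < D by exact: qword_gt0.
have dual b z : wedge b (mat_word A (rev w) *m z) = D * wedge (mat_word nadj w *m b) z.
  by rewrite wedge_word revK.
have up : alpha1 (mat_word A (rev w)) <= D * Gam.
  apply: alpha1_le => z; apply: enorm_le_wedge => [|x].
    by rewrite !mulr_ge0 ?enorm_ge0 // ltW.
  rewrite dual normrM (gtr0_norm D0) -!mulrA ler_pM2l //.
  apply: le_trans (ler_wedge _ _) _; rewrite [leRHS]mulrA [leRHS]mulrAC.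
  by rewrite ler_wpM2r ?enorm_ge0.
have invG b : enorm b <= Gam * enorm (mat_word nadj w *m b).
  have [->|b0] := eqVneq b 0; first by rewrite enorm0 mulr_ge0 ?enorm_ge0.
  rewrite -enorm_gt0 in b0.
  rewrite -(ler_pM2r b0) -expr2 -(ger0_norm (sqr_ge0 _)) -wedge_rot.
  rewrite -(wedge_act nadj_det w); apply: le_trans (ler_wedge _ _) _.
  rewrite [Gam * _]mulrC -mulrA ler_wpM2l ?enorm_ge0 //.
  by have := hG (rot b); rewrite enorm_rot.
have low z : D * enorm z <= Gam * enorm (mat_word A (rev w) *m z).
  have [->|z0] := eqVneq z 0; first by rewrite mulmx0 !enorm0 !mulr0.
  rewrite -enorm_gt0 in z0.
  have [b eb] := act_surj nadj_det w (rot z).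
  have := ler_wedge b (mat_word A (rev w) *m z).
  rewrite dual eb wedgeC wedge_rot mulrN normrN normrM (gtr0_norm D0) ger0_norm ?sqr_ge0 //.
  have := invG b; rewrite eb enorm_rot => hb h.
  rewrite -(ler_pM2r z0) -mulrA -expr2; apply: le_trans h _.
  by rewrite [leRHS]mulrAC ler_wpM2r ?enorm_ge0.
have Gp : 0 < Gam.
  rewrite lt_def Gam0 andbT; apply/eqP => G0.
  have := low (\col_i (i == 0)%:R); rewrite G0 mul0r enorm_e1; lra.
have lo2 : D / Gam <= alpha2 (mat_word A (rev w)).
  by apply: alpha2_ge => z; rewrite mulrAC ler_pdivrMr // [leRHS]mulrC.
move=> hD; have : D / Gam <= C * tau ^+ size w * (D * Gam).
  apply: le_trans lo2 _; apply: le_trans hD _.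
  by case/andP: tau01 => t0 _; rewrite ler_pM2l // mulr_gt0 // exprn_gt0.
rewrite ler_pdivrMr //.
have -> : C * tau ^+ size w * (D * Gam) * Gam = (C * tau ^+ size w * Gam ^+ 2) * D by ring.
by rewrite ler_pMl.
Qed.

Lemma invmat_wordE w : exists t : R, invmat_word A w = t *: mat_word nadj w.
Proof.
elim: w => [|i w [t IH]]; first by exists 1; rewrite scale1r.
exists (qdet i / \det (A i) * t); rewrite /= IH /nadj -scalemxAl -!scalemxAr !scalerA.
congr (_ *: _); field; by rewrite detA gt_eqF ?qdet_gt0.
Qed.

(** A rank one matrix is a column times a row: the column is [b], the transposed row is the vector
    [a] of [limit_dir]. The scalars relating inverses to normalised adjugates are absorbed by the
    free factor in the closure. *)
Lemma furstenberg_limit_dir V : furstenberg A V ->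
  exists2 b, limit_dir nadj b & V = [set t *: b | t in [set: R]].
Proof.
move=> [B [clB [rk eV]]].
have [c [r eB]] : exists (c : 'cV[R]_2) (r : 'rV[R]_2), B = c *m r.
  have := mulmx_base B; move: (col_base B) (row_base B); rewrite rk => c r e.
  by exists c, r.
have c0 : c != 0 by apply/eqP => c0; move: rk; rewrite eB c0 mul0mx mxrank0.
have r0 : r != 0 by apply/eqP => r0; move: rk; rewrite eB r0 mulmx0 mxrank0.
have a0 : r^T != 0 by rewrite -trmx0 (inj_eq trmx_inj).
have Bx x : B *m x = dot2 r^T x *: c.
  rewrite eB -mulmxA (mx11_scalar (r *m x)) mul_mx_scalar; congr (_ *: _).
  by rewrite mxE /dot2; apply: eq_bigr => i _; rewrite mxE.
exists c; last first.
  rewrite eV; apply/seteqP; split => [_ [x _ <-]|_ [t _ <-]].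
    by exists (dot2 r^T x).
  exists ((t / enorm r^T ^+ 2) *: r^T) => //.
  rewrite -scalemxAr Bx scalerA dot2xx divfK // sqrf_eq0 gt_eqF // enorm_gt0 //.
split=> //; exists r^T => // e e0.
(* Passing from a bound on entries to one on the operator costs a factor 2. *)
have e20 : 0 < e / 2 by rewrite divr_gt0.
have [_ [[k _ [w _ <-]] hb]] := clB _ (nbhsx_ballx B _ e20).
have [t et] := invmat_wordE w.
exists (k * t), w => x.
rewrite -Bx scalemxAl -scalerA -et -mulmxBl.
have -> : e = 2 * (e / 2) by rewrite mulrC divfK.
apply: mulmx_entry_bound => i j; rewrite !mxE.
by have := hb.2 i j; rewrite /ball /= => /ltW; rewrite distrC !mxE.
Qed.

Lemma proj_orthE b y : b != 0 -> Defs.proj (orth [set t *: b | t in [set: R]]) y =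
  (wedge b y / enorm b ^+ 2) *: rot b.
Proof.
move=> b0; rewrite -enorm_gt0 in b0.
have n0 : enorm b ^+ 2 != 0 by rewrite sqrf_eq0 gt_eqF.
set p0 := _ *: rot b; set W := orth _.
have Wp z : W z -> dot2 z b = 0 by move=> h; apply: h; exists 1; rewrite ?scale1r.
have W0 : W p0.
  move=> _ [t _ <-]; rewrite /p0 dot2E !mxE /=; ring.
have P0 z : W z -> dot2 (y - p0) z = 0.
  move=> /Wp wz.
  have : enorm b ^+ 2 *: (y - p0) = dot2 y b *: b.
    rewrite scalerBr rot_decomp /p0 scalerA [enorm b ^+ 2 * _]mulrC divfK //.
    by rewrite addrK.
  move=> e; apply: (mulfI n0); rewrite mulr0.
  have -> : enorm b ^+ 2 * dot2 (y - p0) z = dot2 (enorm b ^+ 2 *: (y - p0)) z.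
    by rewrite !dot2E !mxE; ring.
  rewrite e; have -> : dot2 (dot2 y b *: b) z = dot2 y b * dot2 z b by rewrite !dot2E !mxE; ring.
  by rewrite wz mulr0.
(* [p0] is admissible, so [xget] returns an admissible point; the difference of two such points lies
   in [W] and is orthogonal to [W], hence vanishes. *)
rewrite /Defs.proj; case: xgetP => [p _ [Wq Pq]|/(_ p0) []]; last by [].
have Wd : W (p - p0).
  move=> z Vz; have := Wq z Vz; have := W0 z Vz; rewrite !dot2E !mxE; lra.
have : dot2 (p - p0) (p - p0) = 0.
  have := Pq _ Wd; have := P0 _ Wd; rewrite !dot2E !mxE; lra.
rewrite dot2xx => /eqP; rewrite sqrf_eq0 => /eqP /enorm0_eq0 /eqP.
by rewrite subr_eq0 => /eqP.
Qed.

Lemma enorm_proj_orthB b y z : b != 0 ->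
  enorm (Defs.proj (orth [set t *: b | t in [set: R]]) y - Defs.proj (orth [set t *: b | t in [set: R]]) z)
  = `|wedge b (y - z)| / enorm b.
Proof.
move=> b0; rewrite !proj_orthE // -scalerBl -mulrBl -wedgeBr enormZ enorm_rot.
rewrite -enorm_gt0 in b0; rewrite normrM normfV (ger0_norm (sqr_ge0 _)).
by field; rewrite gt_eqF.
Qed.

End Normalized.

(** * Near overlaps and chains *)

Lemma limit_dirZ (R : realType) N (G : 'I_N -> 'M[R]_2) t b :
  t != 0 -> limit_dir G b -> limit_dir G (t *: b).
Proof.
move=> t0 [b0 [a a0 h]]; split; first by rewrite scaler_eq0 negb_or t0.
exists (t^-1 *: a) => [|e e0]; first by rewrite scaler_eq0 negb_or invr_eq0 t0.
have [c [w hw]] := h e e0; exists c, w => x.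
have -> // : dot2 (t^-1 *: a) x *: (t *: b) = dot2 a x *: b.
have -> : dot2 (t^-1 *: a) x = t^-1 * dot2 a x by rewrite !dot2E !mxE; ring.
by rewrite scalerA mulrAC mulVf // mul1r.
Qed.

Lemma geometric_small (R : realType) (a K : R) : 0 < a < 1 -> 0 < K ->
  exists n, a ^+ n * K < 1.
Proof.
move=> a01 K0; have [n0 h] := geometric_vs_square K0 a01 (ltr01 : 0 < 1 :> R) (ltr01 : 0 < 1 :> R).
exists n0; have := h n0 (leqnn _); apply: le_lt_trans.
have /andP[a0 _] := a01.
rewrite mulrC ler_peMr // ?mulr_ge0 ?exprn_ge0 ?(ltW K0) ?(ltW a0) // mulr1.
by rewrite exprn_ege1 // lerDl.
Qed.

(** This margin is what allows the direction of a chain to be perturbed. *)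
Lemma uniform_margin (R : realType) (lo hi : R) (f : nat -> R) M :
  (forall m, (m < M)%N -> lo < f m < hi) ->
  exists2 mu, 0 < mu & forall m, (m < M)%N -> lo + mu <= f m <= hi - mu.
Proof.
elim: M => [|M IH] h; first by exists 1.
have [|mu mu0 hmu] := IH; first by move=> m mM; apply: h; apply: ltnW.
have /andP[h1 h2] := h M (ltnSn M).
exists (Num.min mu (Num.min (f M - lo) (hi - f M))) => [|m].
  by rewrite !lt_min mu0 !subr_gt0 h1 h2.
set nu := Num.min _ _.
have : nu <= nu by []. rewrite {2}/nu !le_min => /and3P[n1 n2 n3].
rewrite ltnS leq_eqVlt => /predU1P[->|/hmu /andP[g1 g2]]; apply/andP; split; lra.
Qed.

(** * Coding, separation and linear functionals on a self-affine set *)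

Section SelfAffine.
Variables (R : realType) (N : nat) (A : 'I_N -> 'M[R]_2) (v : 'I_N -> 'cV[R]_2).
Variables (X : set 'cV[R]_2) (a Delta : R).
Implicit Types (x y z b : 'cV[R]_2) (w : seq 'I_N).
Hypothesis unitA : forall i, A i \in unitmx.
Hypothesis X0 : X !=set0.
Hypothesis Xinv : forall i x, X x -> X (aff A v i x).
Hypothesis Xcov : forall x, X x -> exists i, exists2 y, X y & x = aff A v i y.
Hypothesis Delta0 : 0 < Delta.
Hypothesis Xbd : forall x y, X x -> X y -> enorm (x - y) <= Delta.
Hypothesis a01 : 0 < a < 1.
Hypothesis contr : forall i x, enorm (A i *m x) <= a * enorm x.

Local Notation phi := (aff_word A v).
Local Notation G := (nadj A).
Local Notation act w x := (mat_word G w *m x).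

Let a0 : 0 < a. Proof. by case/andP: a01. Qed.

Lemma aff_wordB w x y : phi w x - phi w y = mat_word A w *m (x - y).
Proof.
elim: w => [|i w IH]; first by rewrite act_nil.
by rewrite act_cons -IH /= /aff opprD addrACA subrr addr0 -mulmxBr.
Qed.

Lemma aff_word_cat u w x : phi (u ++ w) x = phi u (phi w x).
Proof. by rewrite /aff_word foldr_cat. Qed.

Lemma aff_word_in w x : X x -> X (phi w x).
Proof. by move=> Xx; elim: w => //= i w; exact: Xinv. Qed.

Lemma contr_word w x : enorm (mat_word A w *m x) <= a ^+ size w * enorm x.
Proof.
elim: w => [|i w IH]; first by rewrite act_nil expr0 mul1r.
rewrite act_cons exprS -mulrA; apply: le_trans (contr _ _) _.
by rewrite ler_pM2l.
Qed.

Lemma wedge_affB b w x y :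
  wedge b (phi w x - phi w y) = qword A w * wedge (act (rev w) b) (x - y).
Proof. by rewrite aff_wordB wedge_word. Qed.

(** The left side is the norm of the functional [wedge b] composed with the product of the [A i]
    along [w], and each factor contracts by [a]. *)
Lemma qword_act_le w b : qword A w * enorm (act (rev w) b) <= a ^+ size w * enorm b.
Proof.
have q0 := qword_gt0 unitA w.
rewrite -(gtr0_norm q0) -enormZ; apply: enorm_le_wedge => [|x].
  by rewrite mulr_ge0 ?exprn_ge0 ?enorm_ge0 // ltW.
rewrite wedgeC normrN wedgeZl -wedge_word //; apply: le_trans (ler_wedge _ _) _.
rewrite mulrC [leRHS]mulrAC ler_wpM2r ?enorm_ge0 //; exact: contr_word.
Qed.

Lemma coding y0 n : X y0 -> exists w, exists2 y, X y & size w = n /\ y0 = phi w y.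
Proof.
move=> Xy0; elim: n => [|n [w [y Xy [sw e]]]]; first by exists [::], y0.
have [i [y' Xy' ey]] := Xcov Xy.
exists (rcons w i), y' => //; split; first by rewrite size_rcons sw.
by rewrite -cats1 aff_word_cat /= -ey.
Qed.

(** Common first letters cancel, and different first letters contradict separation. If one word is a
    prefix of the other, a nonempty word would act as the identity on [X], although its image lies
    in a single piece and there are at least two. *)
Lemma aff_words_distinct w1 w2 : (2 <= N)%N -> strong_separation A v X -> w1 != w2 ->
  ~ (forall x, X x -> phi w1 x = phi w2 x).
Proof.
move=> N2 ssc.
have disj i j x y : i != j -> X x -> X y -> aff A v i x <> aff A v j y.
  move=> ij Xx Xy e; have := ssc i j ij; rewrite -subset0 => /(_ (aff A v i x)); apply.
  by split; [exists x | exists y].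
have other (i : 'I_N) : exists j : 'I_N, i != j.
  pose j0 : 'I_N := Ordinal (leq_trans (isT : 0 < 2)%N N2).
  pose j1 : 'I_N := Ordinal N2.
  by have [->|] := eqVneq i j0; [exists j1 | exists j0].
have [x0 Xx0] := X0.
have nofix i w : ~ (forall x, X x -> x = phi (i :: w) x).
  move=> h; have [j ij] := other i.
  apply: (disj i j (phi w (aff A v j x0)) x0 ij _ Xx0); first exact/aff_word_in/Xinv.
  by have := h _ (Xinv j Xx0) => /= <-.
elim: w1 w2 => [|i w1 IH] [|j w2] ne h.
- by move: ne; rewrite eqxx.
- exact: (nofix j w2).
- by apply: (nofix i w1) => x Xx; rewrite h.
have [eij|ij] := eqVneq i j.
  apply: (IH w2) => [|x Xx].
    by apply: contra ne => /eqP ->; rewrite eij.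
  have := h x Xx; rewrite /= eij /aff => /addIr /(congr1 (mulmx (invmx (A j)))).
  by rewrite !mulKmx.
by apply: disj (h _ Xx0) => //; exact: aff_word_in.
Qed.

(** A functional is controlled on the span of the differences of [X] by its values on a basis chosen
    among these differences, so the constant does not depend on [c]. The cases are a span of
    dimension two, one and zero. *)
Lemma functional_lipschitz : exists2 C, 0 < C & forall c (m : R),
  (forall y z, X y -> X z -> `|wedge c (y - z)| <= m) ->
  forall y z, X y -> X z -> `|wedge c (y - z)| <= C * m * enorm (y - z).
Proof.
have [x0 Xx0] := X0.
have m_ge0 c m : (forall y z, X y -> X z -> `|wedge c (y - z)| <= m) -> 0 <= m.
  by move=> /(_ _ _ Xx0 Xx0); apply: le_trans.
pose D := [set z | exists x y, [/\ X x, X y & z = x - y]].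
have [[z1 [z2 [[x1 [y1 [Xx1 Xy1 e1]]] [x2 [y2 [Xx2 Xy2 e2]]] w0]]]|] :=
  pselect (exists z1 z2, [/\ D z1, D z2 & wedge z1 z2 != 0]).
  have w0' : 0 < `|wedge z1 z2| by rewrite normr_gt0.
  exists ((enorm z1 + enorm z2 + 1) / `|wedge z1 z2|).
    by rewrite divr_gt0 //; have := enorm_ge0 z1; have := enorm_ge0 z2; lra.
  move=> c m hm y z Xy Xz; set d := y - z.
  have m0 := m_ge0 _ _ hm.
  have := hm _ _ Xx1 Xy1; have := hm _ _ Xx2 Xy2; rewrite -e1 -e2 => h2 h1.
  have e : wedge z1 z2 * wedge c d = wedge d z2 * wedge c z1 + wedge z1 d * wedge c z2.
    by rewrite -wedgeZr wedge_cramer wedgeDr !wedgeZr.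
  rewrite -(ler_pM2l w0') -normrM e; apply: le_trans (ler_normD _ _) _; rewrite !normrM.
  have -> : `|wedge z1 z2| * ((enorm z1 + enorm z2 + 1) / `|wedge z1 z2| * m * enorm d) =
    (enorm z1 + enorm z2 + 1) * m * enorm d by field; rewrite gt_eqF.
  have g1 : `|wedge d z2| * `|wedge c z1| <= enorm d * enorm z2 * m.
    by apply: ler_pM => //; exact: ler_wedge.
  have g2 : `|wedge z1 d| * `|wedge c z2| <= enorm z1 * enorm d * m.
    by apply: ler_pM => //; exact: ler_wedge.
  have g3 : 0 <= m * enorm d by rewrite mulr_ge0 ?enorm_ge0.
  lra.
move=> coll.
have par z1 z2 : D z1 -> D z2 -> wedge z1 z2 = 0.
  by move=> D1 D2; apply: contrapT => /eqP h; apply: coll; exists z1, z2.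
have [[z1 [D1 z10]]|] := pselect (exists z1, D z1 /\ z1 != 0).
  rewrite -enorm_gt0 in z10.
  exists (enorm z1)^-1 => [|c m hm y z Xy Xz]; first by rewrite invr_gt0.
  set d := y - z; have m0 := m_ge0 _ _ hm.
  have Dd : D d by exists y, z.
  have h1 : `|wedge c z1| <= m.
    by have [x1 [y1 [Xx1 Xy1 ->]]] := D1; exact: hm.
  have e : enorm z1 ^+ 2 * wedge c d = dot2 d z1 * wedge c z1.
    by rewrite -!wedgeZr rot_decomp (par _ _ D1 Dd) scale0r addr0.
  rewrite -(ler_pM2l (exprn_gt0 2 z10)) -(ger0_norm (sqr_ge0 (enorm z1))) -normrM e normrM.
  rewrite (ger0_norm (sqr_ge0 _)).
  have -> : enorm z1 ^+ 2 * ((enorm z1)^-1 * m * enorm d) = enorm d * enorm z1 * m.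
    by field; rewrite gt_eqF.
  by apply: ler_pM => //; exact: ler_dot2.
move=> triv; exists 1 => // c m hm y z Xy Xz.
have [->|d0] := eqVneq (y - z) 0; first by rewrite enorm0 mulr0 /wedge !mxE !mulr0 subrr normr0.
by exfalso; apply: triv; exists (y - z); split => //; exists y, z.
Qed.

(** * From near overlaps to chains of points with comparable increments *)

Section Steering.
Variables (L k : R).
Hypothesis L1 : 1 < L.
Hypothesis GL : forall i x, enorm (G i *m x) <= L * enorm x.
Hypothesis GV : forall i x, enorm x <= L * enorm (G i *m x).
Hypothesis Lq : forall i, L^-1 <= qdet A i.
Hypothesis k0 : 0 < k.
Hypothesis grow : forall b, limit_dir G b -> forall w x,
  k * (enorm (act w x) * enorm b) <= enorm (act w b) * enorm x.
Hypothesis steer : forall b e, limit_dir G b -> 0 < e -> exists w, forall b', limit_dir G b' ->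
  exists2 t, t != 0 & enorm (t *: act w b' - b) <= e.

Let L0 : 0 < L. Proof. by apply: lt_trans L1. Qed.

Lemma near_overlap : (2 <= N)%N -> strong_separation A v X -> ~ projective_osc A v X ->
  ~ (exists V, furstenberg A = [set V]) -> forall eta : R, 0 < eta ->
  exists b w1 w2, [/\ limit_dir G b,
    exists2 x, X x & wedge b (phi w1 x - phi w2 x) != 0 &
    forall x, X x -> `|wedge b (phi w1 x - phi w2 x)| <=
      eta * (qword A w1 * enorm (act (rev w1) b))].
Proof.
move=> N2 ssc nposc nsing eta eta0; apply: contrapT => contra_; apply: nposc.
(* The direction [b] accounts for a quarter of [eta * Q] and its perturbation for another quarter;
   the remaining factor 2 pays for [Q] possibly halving under the perturbation. *)
pose eps := eta / (4 * Delta).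
have eps0 : 0 < eps by rewrite divr_gt0 // mulr_gt0.
exists eps; split => // V FV w1 w2 w12; apply: contrapT => noX; apply: contra_.
have [b lb eV] := furstenberg_limit_dir unitA FV.
have b0 : b != 0 by case: lb.
have bp : 0 < enorm b by rewrite enorm_gt0.
set Q := qword A w1 * enorm (act (rev w1) b).
have gdet := nadj_det unitA.
have Q0 : 0 < Q by rewrite mulr_gt0 ?qword_gt0 // enorm_gt0 (act_neq0 L1 GV).
have small x : X x -> `|wedge b (phi w1 x - phi w2 x)| <= eps * (Delta * Q).
  move=> Xx; have h : enorm (Defs.proj (orth V) (phi w1 x) - Defs.proj (orth V) (phi w2 x)) <
      eps * diam (Defs.proj (orth V) @` (phi w1 @` X)).
    by rewrite ltNge; apply/negP => h; apply: noX; exists x.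
  have hd : diam (Defs.proj (orth V) @` (phi w1 @` X)) <= Delta * Q / enorm b.
    apply: ge_sup.
      have [x0 Xx0] := X0; pose p := Defs.proj (orth V) (phi w1 x0).
      have Sp : (Defs.proj (orth V) @` (phi w1 @` X)) p by exists (phi w1 x0) => //; exists x0.
      by exists (enorm (p - p)), p => //; exists p.
    move=> _ [_ [_ [y Xy <-] <-] [_ [_ [z Xz <-] <-] <-]].
    rewrite eV enorm_proj_orthB // ler_pM2r ?invr_gt0 // wedge_affB normrM.
    rewrite (gtr0_norm (qword_gt0 unitA _)) [leRHS]mulrC /Q -mulrA ler_pM2l ?qword_gt0 //.
    apply: le_trans (ler_wedge _ _) _; rewrite ler_wpM2l ?enorm_ge0 //; exact: Xbd.
  have := lt_le_trans h (ler_wpM2l (ltW eps0) hd).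
  rewrite eV enorm_proj_orthB // => /ltW.
  by rewrite [leRHS]mulrA ler_pM2r ?invr_gt0.
have [V' [FV' VV']] : exists V', furstenberg A V' /\ V' <> V.
  apply: contrapT => h; apply: nsing; exists V; apply/seteqP; split => [V' FV'|V' ->] //.
  by apply: contrapT => ne; apply: h; exists V'.
have [b' lb' eV'] := furstenberg_limit_dir unitA FV'.
have b'0 : b' != 0 by case: lb'.
have wbb' : wedge b b' != 0.
  apply/eqP => w0; apply: VV'; rewrite eV eV'.
  have nb : enorm b ^+ 2 != 0 by rewrite sqrf_eq0 gt_eqF.
  have := rot_decomp b' b; rewrite w0 scale0r addr0.
  move/(congr1 (fun z => (enorm b ^+ 2)^-1 *: z)); rewrite !scalerA mulVf // scale1r.
  set s := (_ * _) => e.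
  have s0 : s != 0 by apply: contraNneq b'0 => s0; rewrite e s0 scale0r.
  apply/seteqP; split => [_ [t _ <-]|_ [t _ <-]].
    by exists (t * s) => //; rewrite e scalerA.
  by exists (t / s) => //; rewrite e scalerA divfK.
pose e2 := Num.min (eps * Q) (Q / 2).
have e20 : 0 < e2 by rewrite lt_min mulr_gt0 // divr_gt0.
have : e2 <= e2 by []. rewrite {2}/e2 le_min => /andP[e2a e2b].
(* One word sends both [b] and the non-parallel [b'] close to [b], and the images remain
   non-parallel. If both of them annihilated every displacement, the two maps would agree on [X]. *)
have [h hh] := steer lb e20.
have good bb : limit_dir G bb -> enorm (bb - b) <= e2 ->
    forall x, X x -> `|wedge bb (phi w1 x - phi w2 x)| <=
      eta * (qword A w1 * enorm (act (rev w1) bb)).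
  move=> lbb nbb x Xx.
  have l1 : `|wedge bb (phi w1 x - phi w2 x)| <= eps * (Delta * Q) + e2 * Delta.
    rewrite -{1}(subrK b bb) addrC wedgeDl; apply: le_trans (ler_normD _ _) _.
    apply: lerD; first exact: small.
    apply: le_trans (ler_wedge _ _) _; apply: ler_pM; rewrite ?enorm_ge0 //.
    by apply: Xbd; exact: aff_word_in.
  have l2 : Q / 2 <= qword A w1 * enorm (act (rev w1) bb).
    have h1 : Q - qword A w1 * enorm (act (rev w1) (bb - b)) <= qword A w1 * enorm (act (rev w1) bb).
      rewrite /Q -mulrBr ler_pM2l ?qword_gt0 // mulmxBr enormB.
      have := ler_enorm_sub (act (rev w1) b) (act (rev w1) b - act (rev w1) bb).
      by rewrite subKr.
    have h2 := qword_act_le w1 (bb - b).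
    have h3 : a ^+ size w1 * enorm (bb - b) <= enorm (bb - b).
      rewrite ler_piMl ?enorm_ge0 // exprn_ile1 ?(ltW a0) //.
      by case/andP: a01 => _ /ltW.
    lra.
  apply: le_trans l1 _; apply: le_trans (_ : eta * (Q / 2) <= _); last by rewrite ler_pM2l.
  have : e2 * Delta <= eps * Q * Delta by rewrite ler_pM2r.
  have : eps * Delta = eta / 4 by rewrite /eps; field; rewrite gt_eqF.
  move=> ee hh2; have : eps * Delta * Q = eta / 4 * Q by rewrite ee.
  lra.
have [t1 t10 n1] := hh _ lb; have [t2 t20 n2] := hh _ lb'.
set b1 := t1 *: _ in n1; set b2 := t2 *: _ in n2.
have lact := limit_dir_act L1 GL GV.
have lb1 : limit_dir G b1 by apply: limit_dirZ => //; exact: lact.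
have lb2 : limit_dir G b2 by apply: limit_dirZ => //; exact: lact.
have w12b : wedge b1 b2 != 0.
  rewrite /b1 /b2 wedgeZl wedgeZr !mulf_neq0 // -normr_gt0.
  by rewrite (wedge_act gdet) normr_gt0.
have [[x Xx nz]|z1] := pselect (exists2 x, X x & wedge b1 (phi w1 x - phi w2 x) != 0).
  by exists b1, w1, w2; split => //; [exists x | exact: good].
have [[x Xx nz]|z2] := pselect (exists2 x, X x & wedge b2 (phi w1 x - phi w2 x) != 0).
  by exists b2, w1, w2; split => //; [exists x | exact: good].
exfalso; apply: (aff_words_distinct N2 ssc w12) => x Xx.
apply/eqP; rewrite -subr_eq0; apply/eqP; apply: (wedge_indep w12b).
  by apply: contrapT => /eqP nz; apply: z1; exists x.
by apply: contrapT => /eqP nz; apply: z2; exists x.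
Qed.

(** The points advance transversally to [b] by comparable amounts. The length of [b] and [rho] are
    free, so only the ratio [c] carries information; [p] is a total sequence in [X] whose first
    [M + 1] terms form the chain. *)
Definition chain (c : R) M := exists b (p : nat -> 'cV[R]_2) (rho : R),
  [/\ limit_dir G b, 0 < rho, forall m, X (p m) &
   forall m, (m < M)%N -> c * rho < wedge b (p m.+1 - p m) < rho].

Lemma chain_append c M b (p : nat -> 'cV[R]_2) (rho : R) y :
  limit_dir G b -> 0 < rho -> (forall m, X (p m)) -> X y ->
  (forall m, (m < M)%N -> c * rho < wedge b (p m.+1 - p m) < rho) ->
  c * rho < wedge b (y - p M) < rho -> chain c M.+1.
Proof.
move=> lb rho0 Xp Xy hp hy.
exists b, (fun m => if (m <= M)%N then p m else y), rho; split => // [m|m].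
  by case: ifP.
rewrite ltnS leq_eqVlt /= => /predU1P[->|mM]; first by rewrite eqxx ltnn.
by rewrite mM orbT; exact: hp.
Qed.

Lemma chain_prepend c M b (p : nat -> 'cV[R]_2) (rho : R) y :
  limit_dir G b -> 0 < rho -> (forall m, X (p m)) -> X y ->
  (forall m, (m < M)%N -> c * rho < wedge b (p m.+1 - p m) < rho) ->
  c * rho < wedge b (p 0%N - y) < rho -> chain c M.+1.
Proof.
move=> lb rho0 Xp Xy hp hy.
exists b, (fun m => if m is n.+1 then p n else y), rho; split => // [[|m]|[|m]] //.
exact: hp.
Qed.

Lemma near_maximum (g : 'cV[R]_2 -> R) (m : R) : (forall y, X y -> `|g y| <= m) ->
  (exists2 x, X x & g x != 0) ->
  exists2 y0, X y0 & g y0 != 0 /\ forall y, X y -> `|g y| <= 2 * `|g y0|.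
Proof.
move=> hm [x Xx gx]; pose E := [set `|g y| | y in X].
have Eub : has_ubound E by exists m => _ [y Xy <-]; exact: hm.
have Esup : has_sup E by split => //; exists `|g x|, x.
have le y : X y -> `|g y| <= sup E by move=> Xy; apply: ub_le_sup => //; exists y.
have s0 : 0 < sup E by apply: lt_le_trans (le x Xx); rewrite normr_gt0.
have [_ [y0 Xy0 <-] hy0] := sup_adherent (divr_gt0 s0 (ltr0n R 2)) Esup.
exists y0 => //; split; first by rewrite -normr_gt0; lra.
by move=> y Xy; apply: le_trans (le y Xy) _; lra.
Qed.

(** Extend the coding of [y0] letter by letter from length [ns], where [S] is at least [T]. As [S]
    tends to 0 and loses at most a factor [c2] per letter, it is still at least [c2 * T] when it
    first falls below [T]. *)
Lemma scale_tuning (y0 : 'cV[R]_2) (S : seq 'I_N -> R) (c2 B T : R) (ns : nat) :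
  X y0 -> 0 < c2 -> 0 < B -> 0 < T ->
  (forall w i, c2 * S w <= S (rcons w i)) -> (forall w, S w <= a ^+ size w * B) ->
  T <= c2 ^+ ns * S [::] ->
  exists w, exists2 y, X y & [/\ y0 = phi w y, (ns <= size w)%N & c2 * T <= S w < T].
Proof.
move=> Xy0 c20 B0 T0 step up start; apply: contrapT => none.
have low w : c2 ^+ size w * S [::] <= S w.
  elim/last_ind: w => [|w i IH]; first by rewrite expr0 mul1r.
  apply: le_trans (step w i); rewrite size_rcons exprS -mulrA ler_pM2l //.
have all_big j : exists w, exists2 y, X y & [/\ size w = (ns + j)%N, y0 = phi w y & T <= S w].
  elim: j => [|j [w [y Xy [sw ey Tw]]]].
    have [w [y Xy [sw ey]]] := coding ns Xy0.
    exists w, y => //; split; rewrite ?addn0 //.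
    by apply: le_trans start _; rewrite -sw.
  have [i [y' Xy' ey']] := Xcov Xy.
  have ew : y0 = phi (rcons w i) y' by rewrite -cats1 aff_word_cat /= -ey'.
  exists (rcons w i), y' => //; split; rewrite ?size_rcons ?sw ?addnS //.
  rewrite leNgt; apply/negP => lt; apply: none; exists (rcons w i), y' => //; split => //.
    by rewrite size_rcons sw -addnS leq_addr.
  by rewrite lt andbT (le_trans _ (step _ _)) // ler_pM2l.
have [j hj] := geometric_small a01 (divr_gt0 B0 T0).
have [w [y _ [sw _ Tw]]] := all_big j.
have := le_trans Tw (up w); rewrite sw exprD -mulrA => h.
have aj : 0 < a ^+ j * B by rewrite mulr_gt0 // exprn_gt0.
have : a ^+ ns * (a ^+ j * B) <= a ^+ j * B.
  rewrite ler_piMl ?(ltW aj) // exprn_ile1 ?(ltW a0) //.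
  by case/andP: a01 => _ /ltW.
by move: hj; rewrite (mulrA (a ^+ j)) ltr_pdivrMr // mul1r; lra.
Qed.

Lemma chain_step M : (forall eta : R, 0 < eta -> exists b w1 w2, [/\ limit_dir G b,
    exists2 x, X x & wedge b (phi w1 x - phi w2 x) != 0 &
    forall x, X x -> `|wedge b (phi w1 x - phi w2 x)| <=
      eta * (qword A w1 * enorm (act (rev w1) b))]) ->
  chain (k / L ^+ 2 / 16) M -> chain (k / L ^+ 2 / 16) M.+1.
Proof.
set c2 := k / L ^+ 2 => overlap [b [p [rho [lb rho0 Xp hp]]]].
have c20 : 0 < c2 by rewrite divr_gt0 // exprn_gt0.
have b0 : 0 < enorm b by rewrite enorm_gt0; case: lb.
have [mu mu0 hmu] := uniform_margin hp.
(* A direction within [eps] of [b] keeps all inequalities of the chain, and its norm lies between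
   one half and three halves of that of [b]. *)
pose eps := Num.min (mu / (2 * Delta)) (enorm b / 2).
have eps0 : 0 < eps by rewrite lt_min !divr_gt0 // mulr_gt0.
have : eps <= eps by []. rewrite {2}/eps le_min => /andP[epsa epsb].
have stable bb : enorm (bb - b) <= eps -> forall m, (m < M)%N ->
    c2 / 16 * rho < wedge bb (p m.+1 - p m) < rho.
  move=> hbb m mM; have /andP[h1 h2] := hmu m mM.
  have : `|wedge (bb - b) (p m.+1 - p m)| <= mu / 2.
    apply: le_trans (ler_wedge _ _) _.
    apply: le_trans (_ : eps * Delta <= _).
      by apply: ler_pM; rewrite ?enorm_ge0 //; exact: Xbd.
    by move: epsa; rewrite ler_pdivlMr ?mulr_gt0 //; lra.
  rewrite wedgeBl ler_norml => /andP[h3 h4]; apply/andP; split; lra.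
have [h hh] := steer lb eps0.
have [CX CX0 hCX] := functional_lipschitz.
(* Words of length at least [ns] have images so small that [g] below varies on them by at most half
   of its near maximum. *)
have [|ns hns] := @geometric_small _ a (8 * CX * Delta) a01; first by rewrite !mulr_gt0.
pose Lh := L ^+ size h; have Lh0 : 0 < Lh by rewrite exprn_gt0.
pose qh := qword A (rev h); have qh0 : 0 < qh by exact: qword_gt0.
(* Chosen so that the target scale [T] below is still at most [c2 ^+ ns * S [::]]. *)
pose eta := c2 ^+ ns.+1 * (qh / Lh) * (rho / (3 * enorm b)).
have eta0 : 0 < eta.
  apply: mulr_gt0; last by rewrite divr_gt0 // mulr_gt0.
  by rewrite mulr_gt0 ?exprn_gt0 // divr_gt0.
have [b' [w1 [w2 [lb' nz sm]]]] := overlap eta eta0.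
pose g y := wedge b' (phi w1 y - phi w2 y).
have [y0 Xy0 [gy0 gmax]] := near_maximum sm nz.
rewrite -/(g y0) in gy0; have {}gmax y : X y -> `|g y| <= 2 * `|g y0| by exact: gmax.
set Gm := `|g y0| in gmax; have Gm0 : 0 < Gm by rewrite normr_gt0.
have Gsm := sm y0 Xy0; rewrite -/(g y0) -/Gm in Gsm.
set Q := qword A w1 * _ in Gsm.
(* The innermost block [rev h] makes the functional pulled back from [b'] end with the action of
   [h], hence nearly parallel to [b], whatever [w] is. *)
pose W w := w1 ++ (w ++ rev h).
pose bw w := act (rev w) (act (rev w1) b').
have lact := limit_dir_act L1 GL GV.
have lbw w : limit_dir G (bw w) by apply/lact/lact.
have WE w : act (rev (W w)) b' = act h (bw w).
  by rewrite /W !rev_cat revK !act_cat.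
have qW w : qword A (W w) = qword A w1 * qword A w * qh.
  by rewrite /W !qword_cat mulrA.
pose S w := qword A (W w) * enorm (act h (bw w)).
(* [bw (rcons w i)] is again a limit direction, so [h] expands it at least [k] times as much as
   [bw w]; the letter [i] itself costs at most [L] in length and [L] in [qdet]. *)
have Sstep w i : c2 * S w <= S (rcons w i).
  have D0 := qword_gt0 unitA (W w).
  have ebw : bw (rcons w i) = G i *m bw w by rewrite /bw rev_rcons act_cons.
  have eq : qword A (W (rcons w i)) = qword A (W w) * qdet A i.
    by rewrite !qW -cats1 qword_cat /qword big_seq1; ring.
  rewrite /S eq ebw.
  have := grow (lbw (rcons w i)) h (bw w); rewrite ebw => hg.
  have bw0 : 0 < enorm (G i *m bw w) by rewrite -ebw enorm_gt0; case: (lbw (rcons w i)).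
  set U := enorm (act h (bw w)) in hg *; set U' := enorm (act h _) in hg *.
  have U'0 : 0 <= U' by exact: enorm_ge0.
  have kU : k * U <= L * U'.
    rewrite -(ler_pM2r bw0) -mulrA; apply: le_trans hg _.
    by rewrite [L * U']mulrC -mulrA ler_wpM2l.
  have LU : U' / L <= qdet A i * U' by rewrite mulrC ler_wpM2r.
  have -> : c2 * (qword A (W w) * U) = qword A (W w) * (k * U / L ^+ 2) by rewrite /c2; ring.
  rewrite -[leRHS]mulrA ler_pM2l //; apply: le_trans LU.
  rewrite ler_pdivrMr ?exprn_gt0 //; apply: le_trans kU _.
  by rewrite expr2 mulrA divfK ?gt_eqF // mulrC.
have Sup w : S w <= a ^+ size w * enorm b'.
  rewrite /S -WE; apply: le_trans (qword_act_le _ _) _.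
  rewrite ler_wpM2r ?enorm_ge0 // ler_wiXn2l ?(ltW a0) //; first by case/andP: a01 => _ /ltW.
  by rewrite /W !size_cat addnCA leq_addr.
have S0 : qh / Lh * Q <= S [::].
  rewrite /S qW /bw act_nil /Q; have := act_ge L1 GV h (act (rev w1) b').
  rewrite -/Lh (_ : qword A [::] = 1) ?mulr1 => [hge|]; last by rewrite /qword big_nil.
  have q10 := qword_gt0 unitA w1.
  have -> : qh / Lh * (qword A w1 * enorm (act (rev w1) b')) =
    qword A w1 * qh * (enorm (act (rev w1) b') / Lh) by ring.
  by rewrite ler_pM2l ?mulr_gt0 // ler_pdivrMr // mulrC.
(* With [S w] between [c2 * T] and [T], the new scale [|sg| * rho] lies between [2 * Gm] and
   [6 * Gm / c2]. The new increment will lie between [Gm / 2] and [3 / 2 * Gm], which is where the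
   16 in the ratio comes from. *)
pose T := 3 * Gm * enorm b / (c2 * rho).
have T0 : 0 < T by apply: divr_gt0; [rewrite !mulr_gt0 | rewrite mulr_gt0].
have start : T <= c2 ^+ ns * S [::].
  have c2n : 0 < c2 ^+ ns by rewrite exprn_gt0.
  apply: le_trans (_ : c2 ^+ ns * (qh / Lh * Q) <= _); last by rewrite ler_pM2l.
  rewrite /T (ler_pdivrMr _ _ (mulr_gt0 c20 rho0)).
  have -> : c2 ^+ ns * (qh / Lh * Q) * (c2 * rho) = 3 * (eta * Q) * enorm b.
    by rewrite /eta exprS; field; rewrite !gt_eqF.
  by rewrite ler_pM2r // ler_pM2l.
have b'0 : 0 < enorm b' by rewrite enorm_gt0; case: lb'.
have [w [y Xy [ey nsw /andP[Slo Shi]]]] := scale_tuning Xy0 c20 b'0 T0 Sstep Sup start.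
have [t t0 ht] := hh _ (lbw w).
pose sg := qword A (W w) / t.
have moveE m m' : wedge b' (phi (W w) (p m) - phi (W w) (p m')) =
    sg * wedge (t *: act h (bw w)) (p m - p m').
  by rewrite wedge_affB // WE wedgeZl /sg mulrA divfK.
have tn : enorm b / 2 <= `|t| * enorm (act h (bw w)) <= 3 / 2 * enorm b.
  rewrite -enormZ; set u := t *: _ in ht *.
  have := ler_enorm_sub u b; have := ler_enorm_sub b u; rewrite (enormB b u) => h1 h2.
  by apply/andP; split; lra.
have sgn : 3 / 2 * Gm < `|sg| * rho /\ c2 / 16 * (`|sg| * rho) < Gm / 2.
  set V := `|t| * _ in tn; have /andP[tn1 tn2] := tn.
  have tp : `|t| != 0 by rewrite normr_eq0.
  have sV : `|sg| * V = S w.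
    rewrite /sg normrM normfV (gtr0_norm (qword_gt0 unitA _)) /V /S.
    by rewrite mulrA divfK.
  have Trho : c2 * T * rho = 3 * Gm * enorm b.
    by rewrite /T; field; rewrite !gt_eqF.
  have h1 := ler_wpM2l (normr_ge0 sg) tn1; have h2 := ler_wpM2l (normr_ge0 sg) tn2.
  rewrite sV in h1 h2; split.
    have : 2 * Gm <= `|sg| * rho.
      have : c2 * T * rho <= `|sg| * (3 / 2 * enorm b) * rho.
        by rewrite ler_pM2r //; lra.
      rewrite Trho.
      have -> : 3 * Gm * enorm b = 2 * Gm * (3 / 2 * enorm b) by field.
      by rewrite [leRHS]mulrAC ler_pM2r // mulr_gt0 // divr_gt0.
    lra.
  have : c2 * (`|sg| * rho) <= 6 * Gm.
    have c2r := mulr_gt0 c20 rho0.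
    have : c2 * rho * (`|sg| * (enorm b / 2)) <= c2 * rho * T.
      by rewrite ler_pM2l //; lra.
    have -> : c2 * rho * T = 6 * Gm * (enorm b / 2).
      by rewrite -mulrA (mulrC rho) mulrA Trho; field.
    have -> : c2 * rho * (`|sg| * (enorm b / 2)) = c2 * (`|sg| * rho) * (enorm b / 2) by ring.
    by rewrite ler_pM2r // divr_gt0.
  lra.
have [sg1 sg2] := sgn.
have sg0 : sg != 0.
  by apply/eqP => sg0; move: sg1; rewrite sg0 normr0 mul0r; lra.
(* The sign keeps the increments of the transported chain positive. *)
pose b'' := Num.sg sg *: b'.
have lb'' : limit_dir G b'' by apply: limit_dirZ => //; rewrite sgr_eq0.
have rho'0 : 0 < `|sg| * rho by rewrite mulr_gt0 // normr_gt0.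
have inside m : (m < M)%N -> c2 / 16 * (`|sg| * rho) <
    wedge b'' (phi (W w) (p m.+1) - phi (W w) (p m)) < `|sg| * rho.
  move=> mM; rewrite /b'' wedgeZl moveE mulrA -normrEsg.
  have /andP[h1 h2] := stable _ ht m mM.
  by rewrite mulrCA !ltr_pM2l ?normr_gt0 // h1.
pose z m := phi (w ++ rev h) (p m).
have gz m : `|g (z m) - g y0| <= Gm / 2.
  (* Differences of values of [g] are values of one linear functional, so [functional_lipschitz]
     applies. *)
  pose cc := qword A w1 *: act (rev w1) b' - qword A w2 *: act (rev w2) b'.
  have gcc y1 y2 : g y1 - g y2 = wedge cc (y1 - y2).
    by rewrite /cc wedgeBl !wedgeZl -!wedge_affB // /g !wedgeBr; ring.
  have Xz : X (z m) by exact: aff_word_in.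
  have hm y1 y2 : X y1 -> X y2 -> `|wedge cc (y1 - y2)| <= 4 * Gm.
    move=> X1 X2; rewrite -gcc; apply: le_trans (ler_normB _ _) _.
    by have := gmax _ X1; have := gmax _ X2; lra.
  rewrite gcc; apply: le_trans (hCX cc _ hm _ _ Xz Xy0) _.
  have zy : enorm (z m - y0) <= a ^+ ns * Delta.
    rewrite ey /z aff_word_cat aff_wordB; apply: le_trans (contr_word _ _) _.
    apply: ler_pM; rewrite ?exprn_ge0 ?enorm_ge0 ?(ltW a0) //.
      by rewrite ler_wiXn2l ?(ltW a0) //; case/andP: a01 => _ /ltW.
    by apply: Xbd => //; exact: aff_word_in.
  apply: le_trans (_ : CX * (4 * Gm) * (a ^+ ns * Delta) <= _).
    by rewrite ler_pM2l // !mulr_gt0.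
  have -> : CX * (4 * Gm) * (a ^+ ns * Delta) = a ^+ ns * (8 * CX * Delta) * (Gm / 2) by field.
  by rewrite ger_pMl ?divr_gt0 // ltW.
have XW m : X (phi (W w) (p m)) by exact: aff_word_in.
have Xz m : X (phi w2 (z m)) by do 2 apply: aff_word_in.
have newE m : wedge b'' (phi (W w) (p m) - phi w2 (z m)) = Num.sg sg * g (z m).
  by rewrite /b'' wedgeZl /W aff_word_cat.
have sgG : `|Num.sg sg * g y0| = Gm by rewrite normrM normr_sg sg0 mul1r.
have sgz m : `|Num.sg sg * g (z m) - Num.sg sg * g y0| <= Gm / 2.
  by rewrite -mulrBr normrM normr_sg sg0 mul1r.
(* The sign of [g] decides whether the image under [phi w2] precedes the first point or follows the
   last one. *)
have [pos|neg] := leP 0 (Num.sg sg * g y0).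
  rewrite (ger0_norm pos) in sgG.
  apply: (chain_prepend lb'' rho'0 XW (Xz 0%N) inside); rewrite newE.
  by have := sgz 0%N; rewrite sgG ler_norml => /andP[h1 h2]; apply/andP; split; lra.
rewrite (ltr0_norm neg) in sgG.
apply: (chain_append lb'' rho'0 XW (Xz M) inside).
rewrite -opprB wedgeNr newE.
by have := sgz M; rewrite ler_norml => /andP[h1 h2]; apply/andP; split; lra.
Qed.

End Steering.
End SelfAffine.

(** * Assouad dimension *)

Section Flattening.
Variables (R : realType) (N : nat) (A : 'I_N -> 'M[R]_2).
Hypothesis unitA : forall i, A i \in unitmx.

(* If [c G_w] is close to the rank one map [x |-> (al . x) b], then the adjugate of [G_w], which is
   a multiple of [A_(rev w)], is close to a multiple of [z |-> wedge b z] times a fixed vector. *)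
Lemma flattening b (e : R) : limit_dir (nadj A) b -> 0 < e -> exists w, exists2 sg, 0 < sg &
  forall z, sg * (`|wedge b z| - e * enorm z) <= enorm (mat_word A w *m z)
            <= sg * (`|wedge b z| + e * enorm z).
Proof.
move=> [b0 [al al0 hb]] e0; rewrite -enorm_gt0 in b0; rewrite -enorm_gt0 in al0.
(* The bound by [enorm b / 2] keeps [c] nonzero. *)
pose f := enorm al * Num.min e (enorm b / 2).
have f0 : 0 < f by rewrite mulr_gt0 // lt_min e0 divr_gt0.
have fe : f <= enorm al * e by rewrite ler_pM2l // ge_min lexx.
have fb : f < enorm al * enorm b.
  by rewrite ltr_pM2l // gt_min; apply/orP; right; lra.
have [c [w hw]] := hb f f0.
have c0 : 0 < `|c|.
  rewrite normr_gt0; apply/eqP => c0; have := hw al.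
  rewrite c0 scale0r sub0r enormN enormZ dot2xx ger0_norm ?sqr_ge0 //.
  by rewrite expr2 mulrAC ler_pM2r // leNgt fb.
set D := qword A (rev w); have D0 : 0 < D by exact: qword_gt0.
exists (rev w), (D * enorm al / `|c|) => [|z]; first by rewrite divr_gt0 // mulr_gt0.
set y := mat_word A (rev w) *m z.
have dual x : c * wedge x y = D * (dot2 al x * wedge b z +
    wedge (c *: (mat_word (nadj A) w *m x) - dot2 al x *: b) z).
  by rewrite wedge_word // revK -/D wedgeBl !wedgeZl; ring.
have err x : `|wedge (c *: (mat_word (nadj A) w *m x) - dot2 al x *: b) z| <= 
    enorm al * e * enorm x * enorm z.
  apply: le_trans (ler_wedge _ _) _; rewrite ler_wpM2r ?enorm_ge0 //.
  by apply: le_trans (hw x) _; rewrite ler_wpM2r ?enorm_ge0.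
apply/andP; split; last first.
  have w0 := normr_ge0 (wedge b z); have z0 := enorm_ge0 z.
  apply: enorm_le_wedge => [|x].
    by rewrite mulr_ge0 ?addr_ge0 ?mulr_ge0 ?invr_ge0 // ltW.
  rewrite -(ler_pM2l c0) -normrM dual normrM (gtr0_norm D0).
  have -> : `|c| * (D * enorm al / `|c| * (`|wedge b z| + e * enorm z) * enorm x) =
    D * (enorm al * enorm x * `|wedge b z| + enorm al * e * enorm x * enorm z).
    by field; rewrite gt_eqF.
  rewrite ler_pM2l //; apply: le_trans (ler_normD _ _) _; apply: lerD => //.
  by rewrite normrM ler_wpM2r //; exact: ler_dot2.
rewrite -(ler_pM2l (mulr_gt0 c0 al0)).
have -> : `|c| * enorm al * (D * enorm al / `|c| * (`|wedge b z| - e * enorm z)) =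
    D * (enorm al ^+ 2 * `|wedge b z| - enorm al * e * enorm al * enorm z).
  by field; rewrite gt_eqF.
apply: le_trans (_ : `|c * wedge al y| <= _); last first.
  by rewrite normrM -mulrA ler_pM2l //; exact: ler_wedge.
rewrite dual normrM (gtr0_norm D0) ler_pM2l // dot2xx.
have := err al; rewrite dot2xx; set E := wedge (_ - _) z => hE.
have := lerB_normD (enorm al ^+ 2 * wedge b z) E.
by rewrite normrM (ger0_norm (sqr_ge0 _)); lra.
Qed.

End Flattening.

(** * Coverings, separated points and exponents *)

Section AssouadBounds.
Variable R : realType.
Implicit Types (Y : set 'cV[R]_2).

Lemma chain_spread (f : nat -> R) (c rho : R) M : 0 < c -> 0 < rho ->
  (forall m, (m < M)%N -> c * rho < f m.+1 - f m < rho) ->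
  forall m n, (m < n)%N -> (n <= M)%N -> c * rho <= f n - f m <= (n - m)%:R * rho.
Proof.
move=> c0 rho0 h m n; elim: n => // n IH; rewrite ltnS leq_eqVlt => /predU1P[->|mn] nM.
  by have /andP[h1 h2] := h n nM; rewrite subSnn mul1r !ltW.
have /andP[h1 h2] := h n nM; have /andP[g1 g2] := IH mn (ltnW nM).
have cr : 0 < c * rho by rewrite mulr_gt0.
rewrite subSn ?(ltnW mn) // -natr1 mulrDl mul1r; apply/andP; split; lra.
Qed.

Lemma separated_leq_cover (q : nat -> 'cV[R]_2) M (r : R) (cs : seq 'cV[R]_2) :
  (forall m n, (m < n)%N -> (n <= M)%N -> 2 * r <= enorm (q n - q m)) ->
  (forall m, (m <= M)%N -> exists2 c, c \in cs & enorm (q m - c) < r) ->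
  (M < size cs)%N.
Proof.
move=> sep cov.
have /choice[f hf] : forall m, exists c, (m <= M)%N -> c \in cs /\ enorm (q m - c) < r.
  by move=> m; case: leqP => [/cov [c c1 c2]|_]; [exists c | exists 0].
have inj m n : (m < n)%N -> (n <= M)%N -> f m <> f n.
  move=> mn nM e; have := sep m n mn nM; apply/negP; rewrite -ltNge.
  have [_ h1] := hf m (leq_trans (ltnW mn) nM); have [_ h2] := hf n nM.
  have -> : q n - q m = (q n - f n) - (q m - f m) by rewrite e opprB addrA subrK.
  by apply: le_lt_trans (ler_enormB _ _) _; lra.
have -> : M.+1 = size [seq f m | m <- iota 0 M.+1] by rewrite size_map size_iota.
apply: uniq_leq_size.
  rewrite map_inj_in_uniq ?iota_uniq // => m n.
  rewrite !mem_iota !add0n !ltnS => /= mM nM e.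
  by case: (ltngtP m n) => // lt; [case: (inj m n) | case: (inj n m)].
move=> _ /mapP[m + ->]; rewrite mem_iota add0n ltnS /= => mM.
by have [] := hf m mM.
Qed.

(** With [y = (M + 2) * K], the bound says that [y] is at most a constant times its power [s].
    Choosing [M] so that the power [1 - s] of [y] reaches [T], which exceeds that constant, gives
    the contradiction. *)
Lemma sublinear_power_contra (C K s : R) : 0 < K -> 0 <= s -> s < 1 ->
  ~ (forall M : nat, (M.+1)%:R <= C * powR ((M.+2)%:R * K) s).
Proof.
move=> K0 s0 s1 h.
pose T := 2 * K * `|C| + 1.
have T1 : 1 <= T by rewrite lerDr !mulr_ge0 // ltW.
have u0 : 0 < 1 - s by lra.
pose B := powR T (1 - s)^-1.
pose M := Num.bound (B / K).
have B0 : 0 <= B by exact: powR_ge0.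
pose y := (M.+2)%:R * K.
have y0 : 0 < y by rewrite mulr_gt0.
have By : B <= y.
  rewrite -ler_pdivrMr //; apply: le_trans (ltW (archi_boundP _)) _.
    by rewrite divr_ge0 // ltW.
  by rewrite ler_nat -/M; apply/leqW/leqW.
have Ty : T <= powR y (1 - s).
  have -> : T = powR B (1 - s).
    by rewrite /B -powRrM mulVf ?gt_eqF // powRr1 //; lra.
  by apply: ge0_ler_powR; rewrite ?nnegrE ?(ltW u0) ?(ltW y0).
have ys : 0 < powR y s by exact: powR_gt0.
have yE : y = powR y s * powR y (1 - s).
  have <- : powR y (s + (1 - s)) = powR y s * powR y (1 - s).
    by rewrite powRD // (gt_eqF y0) implybT.
  by rewrite subrKC powRr1 // ltW.
have h1 : (M.+1)%:R <= `|C| * powR y s.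
  by apply: le_trans (h M) _; rewrite ler_pM2r // ler_norm.
have h2 : y <= 2 * K * (M.+1)%:R.
  rewrite /y (mulrAC 2 K) ler_pM2r // -[M.+2]addn1 natrD -[M.+1]addn1 natrD.
  by have : 0 <= M%:R :> R by []; lra.
have h3 : y <= 2 * K * `|C| * powR y s.
  by apply: le_trans h2 _; rewrite -[leRHS]mulrA ler_pM2l // mulr_gt0.
have h4 : T * powR y s <= y by rewrite [leRHS]yE mulrC ler_pM2l.
by move: h4; rewrite /T; lra.
Qed.

(** This makes the set of admissible exponents nonempty, as a lower bound on its [inf] requires. The
    square around the ball is cut into cells of side [r / 2]; there are at most [5 * (Rad / r)] of
    them in each direction, whence 25. *)
Lemma assouad_set_two Y : exists C : R, forall x, Y x -> forall r Rad : R, 0 < r < Rad ->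
  exists cs : seq 'cV[R]_2, (forall c, c \in cs -> Y c) /\
    (size cs)%:R <= C * powR (Rad / r) 2 /\
    (Y `&` [set y | enorm (y - x) < Rad]) `<=` [set y | exists2 c, c \in cs & enorm (y - c) < r].
Proof.
exists 25 => x Yx r Rad /andP[r0 rR].
have Rad0 : 0 < Rad by apply: lt_trans rR.
pose n := (Num.truncn (4 * Rad / r)).+1.
pose idx (y : 'cV[R]_2) i : nat := Num.truncn ((y i 0 - x i 0 + Rad) / (r / 2)).
have r20 : 0 < r / 2 by rewrite divr_gt0.
have coord y i : enorm (y - x) < Rad -> - Rad < y i 0 - x i 0 < Rad.
  move=> hy; rewrite -ltr_norml; apply: le_lt_trans hy.
  rewrite -(@ler_pXn2r _ 2) ?nnegrE ?enorm_ge0 // real_normK ?num_real // enorm_sqr !mxE.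
  have [->|->] : i = 0 \/ i = 1.
    by case: i => [[|[|//]] ?]; [left | right]; exact/val_inj.
  - by rewrite lerDl sqr_ge0.
  - by rewrite lerDr sqr_ge0.
have pos y i : enorm (y - x) < Rad -> 0 <= (y i 0 - x i 0 + Rad) / (r / 2).
  by move=> /(coord _ i) /andP[h1 h2]; rewrite divr_ge0 ?(ltW r20) //; lra.
have idx_lt y i : enorm (y - x) < Rad -> (idx y i < n)%N.
  move=> hy; rewrite /n ltnS /idx; apply: le_truncn.
  rewrite ler_pdivrMr //; have /andP[h1 h2] := coord y i hy.
  have -> : 4 * Rad / r * (r / 2) = 2 * Rad by field; rewrite gt_eqF.
  lra.
have near y z i : enorm (y - x) < Rad -> enorm (z - x) < Rad -> idx y i = idx z i ->
    `|y i 0 - z i 0| <= r / 2.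
  move=> hy hz e.
  have /andP[a1 a2] := truncn_itv (pos y i hy).
  have /andP[b1 b2] := truncn_itv (pos z i hz).
  rewrite -/(idx y i) e in a1 a2; rewrite -/(idx z i) in b1 b2.
  rewrite -[(idx z i).+1]addn1 natrD in a2; rewrite -[(idx z i).+1]addn1 natrD in b2.
  rewrite (ler_pdivlMr _ _ r20) in a1; rewrite (ltr_pdivrMr _ _ r20) in a2.
  rewrite (ler_pdivlMr _ _ r20) in b1; rewrite (ltr_pdivrMr _ _ r20) in b2.
  by rewrite ler_norml; apply/andP; split; lra.
pose P (ij : 'I_n * 'I_n) := [set y | [/\ Y y, enorm (y - x) < Rad, 
  idx y 0 = ij.1 & idx y 1 = ij.2]].
(* Empty cells get the default [x], so that every centre lies in [Y]. *)
pose f ij := xget x (P ij).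
exists [seq f ij | ij <- enum {: 'I_n * 'I_n}]; split; [|split].
- move=> _ /mapP[ij _ ->]; rewrite /f; case: xgetP => [y _ [] //|_]; exact: Yx.
- rewrite size_map -cardE card_prod card_ord powR_mulrn ?divr_ge0 ?(ltW r0) ?(ltW Rad0) //.
  have h0 : 0 <= 4 * Rad / r by rewrite !mulr_ge0 ?invr_ge0 ?(ltW r0) ?(ltW Rad0).
  have /andP[h1 _] := truncn_itv h0.
  have h2 : n%:R <= 5 * (Rad / r).
    rewrite /n -natr1; have : 1 <= Rad / r by rewrite ler_pdivlMr // mul1r ltW.
    by move: h1; rewrite -mulrA; lra.
  have -> : 25 * (Rad / r) ^+ 2 = (5 * (Rad / r)) * (5 * (Rad / r)) by ring.
  by rewrite natrM ler_pM.
- move=> y [Yy hy] /=.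
  pose ij := (Ordinal (idx_lt y 0 hy), Ordinal (idx_lt y 1 hy)).
  exists (f ij); first by apply: map_f; rewrite mem_enum.
  have [Yz hz e0 e1] : P ij (f ij).
    rewrite /f; case: xgetP => [z -> //|/(_ y)]; by case.
  have d0 := near y (f ij) 0 hy hz (esym e0).
  have d1 := near y (f ij) 1 hy hz (esym e1).
  rewrite -(@ltr_pXn2r _ 2) ?nnegrE ?enorm_ge0 ?(ltW r0) // enorm_sqr !mxE.
  have sq t : `|t| <= r / 2 -> t ^+ 2 <= (r / 2) ^+ 2.
    by move=> ht; rewrite -(real_normK (num_real t)) ler_pXn2r ?nnegrE ?(ltW r20).
  have := sq _ d0; have := sq _ d1; have : 0 < r ^+ 2 by rewrite exprn_gt0.
  by rewrite [(r / 2) ^+ 2]exprMn; lra.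
Qed.

End AssouadBounds.

Lemma compact_enorm_bounded (R : realType) (X : set 'cV[R]_2) : compact X ->
  exists2 D, 0 < D & forall x y, X x -> X y -> enorm (x - y) <= D.
Proof.
move=> /compact_bounded [M [_ hM]].
pose B := `|M| + 1.
have MB : M < B by rewrite /B; have := ler_norm M; lra.
have B0 : 0 < B by rewrite /B; have := normr_ge0 M; lra.
have bd x : X x -> enorm x <= 2 * B.
  move=> Xx; have h := hM B MB x Xx.
  have e i : x i 0 ^+ 2 <= B ^+ 2.
    have : `|x i 0| <= B.
      apply: le_trans h; rewrite [leRHS]mx_normrE.
      exact: (le_bigmax _ (fun ij : 'I_2 * 'I_1 => `|x ij.1 ij.2|) (i, 0)).
    by move=> hx; rewrite -(real_normK (num_real (x i 0))) ler_pXn2r ?nnegrE ?(ltW B0).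
  rewrite -(@ler_pXn2r _ 2) ?nnegrE ?enorm_ge0 ?mulr_ge0 ?(ltW B0) // enorm_sqr exprMn.
  have := e 0; have := e 1; have : 0 <= B ^+ 2 by exact: sqr_ge0.
  lra.
exists (4 * B) => [|x y Xx Xy]; first lra.
by apply: le_trans (ler_enormB _ _) _; have := bd x Xx; have := bd y Xy; lra.
Qed.

Theorem mainTheorem7 (R : realType) (N : nat) (A : 'I_N -> 'M[R]_2)
  (v : 'I_N -> 'cV[R]_2) (X : set 'cV[R]_2) :
  (2 <= N)%N ->
  (forall i, A i \in unitmx) ->
  (forall i, alpha1 (A i) < 1) ->
  is_self_affine_set A v X ->
  dominated A ->
  strong_separation A v X ->
  ~ projective_osc A v X ->
  ~ (exists V, furstenberg A = [set V]) ->
  1 <= assouad_dim X.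
Proof.
move=> N2 unitA hA [cX [X0 eX]] dom ssc nposc nsing.
have Xinv i x : X x -> X (aff A v i x) by move=> Xx; rewrite eX; exists i => //; exists x.
have Xcov x : X x -> exists i, exists2 y, X y & x = aff A v i y.
  by move=> Xx; move: (Xx); rewrite {1}eX => -[i _ [y Xy <-]]; exists i, y.
have [Delta Delta0 Xbd] := compact_enorm_bounded cX.
have [a a01 contr] := contraction_bound hA.
have gdet := nadj_det unitA.
have [L L1 hL] := nadj_bounds unitA.
have GL i x : enorm (nadj A i *m x) <= L * enorm x by have [] := hL i.
have GV i x : enorm x <= L * enorm (nadj A i *m x) by have [] := hL i.
have Lq i : L^-1 <= qdet A i by have [] := hL i.
have [C [tau [C0 tau01 grow]]] := dominated_growth unitA dom.
have [k k0 hk] := limit_dir_growth L1 gdet GL GV C0 tau01 grow.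
have steer := steering L1 gdet GL GV C0 tau01 grow.
have overlap := near_overlap unitA X0 Xinv Delta0 Xbd a01 contr L1 GL GV
  steer N2 ssc nposc nsing.
pose c := k / L ^+ 2 / 16.
have L0 : 0 < L by apply: lt_trans L1.
have c0 : 0 < c by rewrite !divr_gt0 // exprn_gt0.
have chains M : chain A X c M.
  elim: M => [|M IH]; last first.
    exact: (chain_step unitA X0 Xinv Xcov Delta0 Xbd a01 contr L1 GL GV Lq k0 hk steer).
  (* The chain without increments only needs some limit direction, which any near overlap
     supplies. *)
  have [b [_ [_ [lb _ _]]]] := overlap 1 ltr01; have [x0 Xx0] := X0.
  by exists b, (fun=> x0), 1.
apply: lb_le_inf.
  by exists 2; split => //; exact: assouad_set_two.
move=> s [s0 [K hK]]; rewrite leNgt; apply/negP => s1.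
apply: (@sublinear_power_contra _ K (4 / c) s) => // [|M].
  by rewrite divr_gt0.
(* One increment more than will be used: even for [M = 0] there is a first increment, which shows
   [c < 1]. *)
have [b [p [rho [lb rho0 Xp hp]]]] := chains M.+1.
have c1 : c < 1.
  have /andP[h1 h2] := hp 0%N isT; have := lt_trans h1 h2.
  by rewrite gtr_pMl.
have spread : forall m n, (m < n)%N -> (n <= M.+1)%N ->
    c * rho <= wedge b (p n - p m) <= (n - m)%:R * rho.
  move=> m n mn nM; rewrite wedgeBr.
  apply: (chain_spread (f := fun m => wedge b (p m)) c0 rho0 _ mn nM) => i iM.
  by rewrite -wedgeBr; exact: hp.
have cr : 0 < c * rho by rewrite mulr_gt0.
have cr1 : c * rho < rho by rewrite gtr_pMl.
(* The flattening error on differences of points of [X] is then at most half the least increment. *)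
pose e := c * rho / (2 * Delta).
have e0 : 0 < e by rewrite divr_gt0 // mulr_gt0.
have eD m n : e * enorm (p n - p m) <= c * rho / 2.
  apply: le_trans (_ : e * Delta <= _); first by rewrite ler_pM2l // Xbd.
  by rewrite /e le_eqVlt; apply/orP; left; apply/eqP; field; rewrite gt_eqF.
have [w [sg sg0 flat]] := flattening unitA lb e0.
pose q m := aff_word A v w (p m).
have Xq m : X (q m) by exact: aff_word_in.
(* Image points are at least [sg * (c * rho / 2) = 2 * r] apart, and within
   [sg * (M * rho + c * rho / 2) < Rad] of the first one. *)
pose r := sg * (c * rho) / 4; pose Rad := sg * ((M.+2)%:R * rho).
have r0 : 0 < r by rewrite divr_gt0 // mulr_gt0.
have M0 : 0 <= M%:R :> R by [].
have M2 : (M.+2)%:R = M%:R + 2 :> R by rewrite -addn2 natrD.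
have rR : r < Rad.
  rewrite /r /Rad -mulrA ltr_pM2l // M2.
  have : 0 <= M%:R * rho by rewrite mulr_ge0 // ltW.
  lra.
have [|cs [_ [sz cov]]] := hK _ (Xq 0%N) r Rad; first by rewrite r0.
have -> : (M.+2)%:R * (4 / c) = Rad / r.
  by rewrite /Rad /r; field; rewrite !gt_eqF.
apply: le_trans sz; rewrite ler_nat; apply: (@separated_leq_cover _ q M r) => [m n mn nM|m mM].
  have /andP[h1 _] := spread m n mn (leqW nM).
  have /andP[f1 _] := flat (p n - p m).
  rewrite /q aff_wordB; apply: le_trans f1.
  have -> : 2 * r = sg * (c * rho / 2) by rewrite /r; field.
  rewrite ler_pM2l //; have := eD m n; have := ler_norm (wedge b (p n - p m)); lra.
apply: cov; split => //=; rewrite /q aff_wordB.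
have /andP[_ f2] := flat (p m - p 0%N); apply: le_lt_trans f2 _.
rewrite /Rad ltr_pM2l // M2.
have wm : `|wedge b (p m - p 0%N)| <= M%:R * rho.
  case: m mM => [|m] mM; first by rewrite subrr /wedge !mxE !mulr0 subrr normr0 mulr_ge0 // ltW.
  have /andP[h1 h2] := spread 0%N m.+1 isT (leqW mM).
  rewrite ger0_norm; last by apply: le_trans h1; exact: ltW.
  by apply: le_trans h2 _; rewrite subn0 ler_pM2r // ler_nat.
by have := eD 0%N m; lra.
Qed.
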